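(* Let $\mu$ be a non-negative tempered Radon measure on $\mathbf R^d$ and let $s\ge0$ be chosen so that $\int_{\mathbf R^d}\langle x\rangle^{-s}\,\mathrm d\mu(x)<\infty$. Then for any $n\in\mathbf N$ and any $\varepsilon>0$ we have $1\otimes\mu\in M^{\infty,1}_\omega(\mathbf R^{2d})$ with $$\omega(x_1,x_2,\xi_1,\xi_2)=\langle x_2\rangle^{-s}\langle\xi_1\rangle^{n}\langle\xi_2\rangle^{-d-\varepsilon},\qquad x_1,x_2,\xi_1,\xi_2\in\mathbf R^d.$$
   Context: Here $\langle x\rangle=(1+|x|^2)^{1/2}$. A non-negative Radon measure $\mu$ on $\mathbf R^d$ is tempered if $\int\langle x\rangle^{-s}\mathrm d\mu(x)<\infty$ for some $s\ge0$. $1\otimes\mu$ is the tempered distribution on $\mathbf R^{2d}$ given by $(1\otimes\mu,\Psi)=\int_{\mathbf R^d}\int_{\mathbf R^d}\overline{\Psi(x,\xi)}\,\mathrm dx\,\mathrm d\mu(\xi)$. For fixed $\Psi\in\mathscr S(\mathbf R^{2d})\setminus\{0\}$ and $a\in\mathscr S'(\mathbf R^{2d})$ let $V_\Psi a(X,\Xi)=(2\pi)^{-d}(a,M_\Xi T_X\Psi)$, $X,\Xi\in\mathbf R^{2d}$, where $T_X\Psi(Y)=\Psi(Y-X)$, $M_\Xi\Psi(Y)=e^{i\langle Y,\Xi\rangle}\Psi(Y)$. The modulation space $M^{\infty,1}_\omega(\mathbf R^{2d})$, for a weight $\omega$ on $\mathbf R^{4d}$, consists of the $a\in\mathscr S'(\mathbf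 R^{2d})$ with finite norm $\int_{\mathbf R^{2d}}\sup_{X\in\mathbf R^{2d}}\bigl(|V_\Psi a(X,\Xi)|\,\omega(X,\Xi)\bigr)\mathrm d\Xi$, with $X=(x_1,x_2)$, $\Xi=(\xi_1,\xi_2)$; it is independent of $\Psi$. *)

(* Defs.v *)
From HB Require Import structures.
From mathcomp Require Import all_boot all_order all_algebra.
From mathcomp Require Import complex.
From mathcomp Require Import all_classical all_reals all_analysis.
From mathcomp Require Import measurable_realfun.

Set Implicit Arguments.
Unset Strict Implicit.
Unset Printing Implicit Defensive.

Import Order.TTheory GRing.Theory Num.Theory.
Import numFieldTopology.Exports numFieldNormedType.Exports.

Local Open Scope classical_set_scope.
Local Open Scope ring_scope.

Local Notation normc := ComplexField.Normc.normc.

Definition borel_rV (R : realType) (n : nat) : measurableType _ :=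
  g_sigma_algebraType (@open 'rV[R]_n).

Section lebesgue_rV.
Variable R : realType.

Definition rV_cons n (p : R * 'rV[R]_n) : 'rV[R]_n.+1 :=
  \row_i (if unlift ord0 i is Some j then p.2 ord0 j else p.1).

Definition rV_uncons n (v : 'rV[R]_n.+1) : R * 'rV[R]_n :=
  (v ord0 ord0, \row_j v ord0 (lift ord0 j)).

Lemma rV_consK n : cancel (@rV_cons n) (@rV_uncons n).
Proof.
move=> [x v]; congr pair; first by rewrite mxE unlift_none.
by apply/rowP => j; rewrite !mxE liftK.
Qed.

Lemma rat_dense_R (x e : R) : 0 < e -> exists q : rat, `|x - ratr q| < e.
Proof.
move=> e0; have [|q] := @rat_in_itvoo R (x - e) (x + e).
  by rewrite ltrD2l gtrN.
by rewrite in_itv/= => /andP[q1 q2]; exists q; rewrite distrC ltr_distl q1.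
Qed.

Lemma rat_dense_rV n (v : 'rV[R]_n) (e : R) : 0 < e ->
  exists q : 'rV[rat]_n, ball v e (map_mx ratr q : 'rV[R]_n).
Proof.
move=> e0.
have /choice[q qP] (j : 'I_n) := rat_dense_R (v ord0 j) e0.
exists (\row_j q j).
suff : @mx_ball _ _ _ _ v e (map_mx ratr (\row_j q j)) by [].
split=> [//|i j].
by rewrite !mxE (ord1 i) -ball_normE /ball_/=; exact: qP.
Qed.

Lemma measurable_open_prod n (U : set (R * 'rV[R]_n)) : open U ->
  measurable (U : set (R * borel_rV R n)).
Proof.
move=> oU.
pose B (t : rat * 'rV[rat]_n * nat) : set (R * borel_rV R n) :=
  (ball (ratr t.1.1 : R) t.2.+1%:R^-1) `*`
  (ball (map_mx ratr t.1.2 : 'rV[R]_n) t.2.+1%:R^-1).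
have mB t : measurable (B t).
  apply: measurableX; first by apply: open_measurable; exact: ball_open.
  by apply: sub_sigma_algebra; exact: ball_open.
suff -> : U = \bigcup_(t in [set t | B t `<=` U]) B t.
  rewrite bigcup_mkcond; apply: countable_bigcupT_measurable; first exact: countableP.
  by move=> t; case: ifP => _; [exact: mB|exact: measurable0].
apply/seteqP; split => [[x v] Uxv|p [t tU]]; last exact: tU.
have /nbhs_ballP[e /= e0 eU] : nbhs (x, v) U by exact: open_nbhs_nbhs.
have [k _ /(_ k (leqnn k)) ke] := near_infty_natSinv_lt (PosNum (divr_gt0 e0 (ltr0Sn R 1))).
have k0 : 0 < k.+1%:R^-1 :> R by rewrite invr_gt0.
have [q qx] := rat_dense_R x k0.
have xq : ball x k.+1%:R^-1 (ratr q : R) by rewrite -ball_normE.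
have [w vw] := rat_dense_rV v k0.
exists (q, w, k); last by split; apply: ball_sym.
move=> [y z] [/= qy wz]; apply: eU; split => /=.
  by apply: le_ball (ball_triangle xq qy); rewrite (splitr e) lerD// ltW.
by apply: le_ball (ball_triangle vw wz); rewrite (splitr e) lerD// ltW.
Qed.

Lemma rV_cons_continuous n : continuous (@rV_cons n).
Proof.
move=> p A /nbhs_ballP[e /= e0 eA]; apply/nbhs_ballP; exists e => // q [pq1 [_ pq2]].
apply: eA; suff : @mx_ball _ _ _ _ (rV_cons p) e (rV_cons q) by [].
by split=> [//|i j]; rewrite !mxE; case: unliftP => [k _|_] //; exact: pq2.
Qed.

Lemma rV_coord_continuous m n (g : 'I_m -> 'I_n) :
  continuous (fun v : 'rV[R]_n => \row_j v ord0 (g j)).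
Proof.
move=> v A /nbhs_ballP[e /= e0 eA]; apply/nbhs_ballP; exists e => // w [_ vw].
apply: eA; suff : @mx_ball _ _ _ _ (\row_j v ord0 (g j)) e (\row_j w ord0 (g j)) by [].
by split=> [//|i j]; rewrite !mxE; exact: vw.
Qed.

Lemma measurable_rV_cons n :
  measurable_fun setT (@rV_cons n : R * borel_rV R n -> borel_rV R n.+1).
Proof.
apply: (@measurability _ _ _ (borel_rV R n.+1) _ _ (@open 'rV[R]_n.+1) erefl) => _ [U oU <-].
rewrite setTI; apply: measurable_open_prod.
by apply: open_comp => // p _; exact: rV_cons_continuous.
Qed.

Lemma measurable_rV_uncons n :
  measurable_fun setT (@rV_uncons n : borel_rV R n.+1 -> R * borel_rV R n).
Proof.
apply: measurable_fun_pair.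
  apply: (@measurability _ _ (borel_rV R n.+1) R _ _ _ (RGenOpens.measurableE R)) => _ [U [a [b ->]] <-].
  rewrite setTI; apply: sub_sigma_algebra; apply: open_comp => [v _|]; last exact: interval_open.
  exact: coord_continuous.
apply: (@measurability _ _ _ (borel_rV R n) _ _ (@open 'rV[R]_n) erefl) => _ [U oU <-].
rewrite setTI; apply: sub_sigma_algebra; apply: open_comp => // v _.
exact: rV_coord_continuous.
Qed.

Section lebesgue_succ.
Variables (n : nat) (m : {sigma_finite_measure set (borel_rV R n) -> \bar R}).

Definition lebesgue_succ : set (borel_rV R n.+1) -> \bar R :=
  pushforward (@lebesgue_measure R \x m)%E
    (@rV_cons n : R * borel_rV R n -> borel_rV R n.+1).

HB.instance Definition _ := Measure.copy lebesgue_succ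
  (measure_function_pushforward__canonical__measure_function_Measure
    (@lebesgue_measure R \x m)%E (@measurable_rV_cons n)).

Lemma lebesgue_succ_sigma_finite : sigma_finite setT lebesgue_succ.
Proof.
have /sigma_finiteP[F [TF ndF Foo]] := sigma_finiteT (@lebesgue_measure R).
have /sigma_finiteP[G [TG ndG Goo]] := sigma_finiteT m.
pose H k : set (R * borel_rV R n) := F k `*` G k.
exists (fun k => @rV_uncons n @^-1` H k).
  apply/seteqP; split=> // v _.
  have [k1 _ Fk] : (\bigcup_k F k) (rV_uncons v).1 by rewrite -TF.
  have [k2 _ Gk] : (\bigcup_k G k) (rV_uncons v).2 by rewrite -TG.
  exists (maxn k1 k2) => //; split.
    by move: Fk; apply/subsetPset/ndF/leq_maxl.
  by move: Gk; apply/subsetPset/ndG/leq_maxr.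
move=> k; have [mF Fk] := Foo k; have [mG Gk] := Goo k; split.
  rewrite -[X in measurable X]setTI.
  by apply: measurable_rV_uncons => //; exact: measurableX.
rewrite /lebesgue_succ /pushforward -comp_preimage.
rewrite (_ : _ \o _ = id); last by apply/funext => p /=; exact: rV_consK.
by rewrite preimage_id product_measure1E// lte_mul_pinfty// ge0_fin_numE.
Qed.

HB.instance Definition _ :=
  Measure_isSigmaFinite.Build _ _ _ lebesgue_succ lebesgue_succ_sigma_finite.

End lebesgue_succ.

Fixpoint lebesgue_rV n : {sigma_finite_measure set (borel_rV R n) -> \bar R} :=
  match n with
  | 0 => dirac ((0 : 'rV[R]_0) : borel_rV R 0)
  | n.+1 => lebesgue_succ (lebesgue_rV n)
  end.

Lemma lebesgue_rV_box n (a b : 'rV[R]_n) : (forall i, a ord0 i <= b ord0 i) ->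
  lebesgue_rV n [set v : 'rV[R]_n | forall i, a ord0 i < v ord0 i <= b ord0 i] =
  (\prod_i (b ord0 i - a ord0 i))%:E.
Proof.
elim: n a b => [|n IH] a b ab.
  by rewrite big_ord0 /= diracE mem_set//= => -[].
pose a' := (rV_uncons a).2; pose b' := (rV_uncons b).2.
have ab' i : a' ord0 i <= b' ord0 i by rewrite !mxE.
pose B : set (borel_rV R n) :=
  [set v : 'rV[R]_n | forall i, a' ord0 i < v ord0 i <= b' ord0 i].
have mB : measurable B.
  pose up (c : R) (i : 'I_n) : set (borel_rV R n) :=
    (fun v : 'rV[R]_n => v ord0 i) @^-1` [set x | c < x].
  have mup c i : measurable (up c i).
    apply: sub_sigma_algebra; apply: open_comp; last exact: open_gt.
    by move=> v _; exact: coord_continuous.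
  rewrite (_ : B = ~` \bigcup_i ~` (up (a' ord0 i) i `&` ~` up (b' ord0 i) i)).
    apply/measurableC/countable_bigcupT_measurable => [|i]; first exact: countableP.
    by apply/measurableC/measurableI => //; exact/measurableC.
  rewrite setC_bigcup; apply/seteqP; split => v /= h i.
    by move=> _; rewrite setCK; have /andP[av vb] := h i; split => //; apply/negP; rewrite -leNgt.
  by have := h i I; rewrite setCK => -[/= -> /negP]; rewrite -leNgt.
rewrite /= /lebesgue_succ /pushforward.
rewrite (_ : _ @^-1` _ = `]a ord0 ord0, b ord0 ord0]%classic `*` B); last first.
  apply/seteqP; split => [[x v] /= h|[x v] /= [h1 h2]].
  - split; first by have := h ord0; rewrite in_itv/= !mxE unlift_none.
    by move=> i; have := h (lift ord0 i); rewrite !mxE liftK.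
  - move=> i; rewrite !mxE; case: unliftP => [j ->|->]; last by move: h1; rewrite in_itv.
    by have := h2 j; rewrite !mxE.
rewrite product_measure1E//= lebesgue_measure_itv/= big_ord_recl EFinM.
rewrite IH//; congr (_ * _)%E; last by congr EFin; apply: eq_bigr => i _; rewrite !mxE.
rewrite lte_fin; case: ltP => // ba.
by congr EFin; apply/eqP; rewrite eq_sym subr_eq0 eq_le ab ba.
Qed.

End lebesgue_rV.

Arguments lebesgue_rV : clear implicits.

Section euclidean.
Variable R : realType.

(* The norm of ['rV[R]_n] in the library is the sup norm, so Euclidean
   quantities are spelled out. *)
Definition dotp n (x y : 'rV[R]_n) : R := \sum_i x ord0 i * y ord0 i.

Definition japanese n (x : 'rV[R]_n) : R := Num.sqrt (1 + dotp x x).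

Definition expi (t : R) : R[i] := Complex (cos t) (sin t).

Definition Cintegral d (T : measurableType d) (m : {measure set T -> \bar R})
    (f : T -> R[i]) : R[i] :=
  Complex (\int[m]_x complex.Re (f x)) (\int[m]_x complex.Im (f x)).

End euclidean.

Section schwartz.
Variables (R : realType) (n : nat).
Implicit Types (f g : 'rV[R]_n -> R[i]) (s : seq 'I_n) (k : nat).

(* Iterated partial derivative along the coordinate directions listed in [s];
   the multi-indices of length [k] correspond to the lists of size [k] up to
   reordering. *)
Definition pderiv s (h : 'rV[R]_n -> R) : 'rV[R]_n -> R :=
  foldr (fun i (g : 'rV[R]_n -> R) x => 'D_(delta_mx ord0 i : 'rV[R]_n) g x) h s.

Definition Cpderiv s f : 'rV[R]_n -> R[i] := fun x =>
  Complex (pderiv s (@complex.Re R \o f) x) (pderiv s (@complex.Im R \o f) x).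

Definition smooth f : Prop := forall s (x : 'rV[R]_n),
  differentiable (pderiv s (@complex.Re R \o f)) x /\
  differentiable (pderiv s (@complex.Im R \o f)) x.

Definition schwartz_seminorm k s f : \bar R :=
  ereal_sup [set (japanese x ^+ k * normc (Cpderiv s f x))%:E
            | x in [set: 'rV[R]_n]].

Definition schwartz f : Prop :=
  smooth f /\ forall k s, (schwartz_seminorm k s f < +oo)%E.

(* The pairing of a distribution with a test function extends the L^2 scalar
   product, hence is conjugate-linear in the test function. A functional is a
   total map of which only the values at Schwartz functions matter; continuity
   is with respect to the locally convex topology generated by the
   seminorms. *)
Definition tempered_distribution (u : ('rV[R]_n -> R[i]) -> R[i]) : Prop :=
  (forall (c : R[i]) f g, schwartz f -> schwartz g ->
     u (fun x => c * f x + g x) = conjc c * u f + u g) /\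
  (forall f, schwartz f -> forall e : R, 0 < e ->
     exists N : nat, exists2 delta : R, 0 < delta &
       forall g, schwartz g ->
         (forall k s, (k <= N)%N -> (size s <= N)%N ->
            (schwartz_seminorm k s (fun x => (g x - f x)%R) < delta%:E)%E) ->
         normc (u g - u f) < e).

End schwartz.

Section radon.
Variables (R : realType) (d : nat).
Implicit Type mu : {measure set (borel_rV R d) -> \bar R}.

Definition radon mu : Prop :=
  (forall K : set 'rV[R]_d, compact K -> (mu K < +oo)%E) /\
  (forall A : set (borel_rV R d), measurable A ->
     mu A = ereal_sup [set mu K | K in
              [set K : set 'rV[R]_d | compact K /\ K `<=` A]]).

Definition tempered_of_order mu (s : R) : Prop :=
  (\int[mu]_x (japanese x `^ (- s))%:E < +oo)%E.

Definition tempered mu : Prop := exists2 s : R, 0 <= s & tempered_of_order mu s.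

(* Points of R^(2d) are row vectors [row_mx x xi]. *)
Definition one_tensor mu (Psi : 'rV[R]_(d + d) -> R[i]) : R[i] :=
  Cintegral mu (fun xi : 'rV[R]_d =>
    Cintegral (lebesgue_rV R d) (fun x : 'rV[R]_d => conjc (Psi (row_mx x xi)))).

End radon.

Section modulation_space.
Variables (R : realType) (d : nat).
Implicit Types (Psi : 'rV[R]_(d + d) -> R[i]) (X Xi : 'rV[R]_(d + d)).
Implicit Types (a : ('rV[R]_(d + d) -> R[i]) -> R[i])
  (w : 'rV[R]_(d + d) -> 'rV[R]_(d + d) -> R).

Definition translate X Psi : 'rV[R]_(d + d) -> R[i] := fun Y => Psi (Y - X).

Definition modulate Xi Psi : 'rV[R]_(d + d) -> R[i] :=
  fun Y => expi (dotp Y Xi) * Psi Y.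

Definition stft Psi a X Xi : R[i] :=
  real_complex R ((2 * pi) ^- d) * a (modulate Xi (translate X Psi)).

Definition modulation_norm Psi w a : \bar R :=
  (\int[lebesgue_rV R (d + d)]_Xi
     ereal_sup [set (normc (stft Psi a X Xi) * w X Xi)%:E
               | X in [set: 'rV[R]_(d + d)]])%E.

(* Membership in M^{oo,1}_w, as measured with the window [Psi]. *)
Definition modulation_space Psi w a : Prop :=
  tempered_distribution a /\ (modulation_norm Psi w a < +oo)%E.

End modulation_space.

(* Main.v *)
(* Write Psi = G1 + i G2.  Splitting Y = (x, xi), the inner integral over x in
   (1 (x) mu)(M_Xi T_X Psi) is a sum of integrals
     osc xi_1 th g = int cos(<y, xi_1> + th) g(y) dy,
   where g = G_j(., xi - x_2) is a slice of a Schwartz function; the shift by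
   x_1 and the frequency xi_2 only enter the phase th.  Integrating by parts,
   multiplication by a coordinate of xi_1 turns osc xi_1 th g into
   osc xi_1 (th + pi/2) (D_j g), so that osc is O(<xi_1>^-N <xi - x_2>^-M)
   uniformly in th.  Integrating in xi against mu with M >= s, Peetre's
   inequality produces the factor <x_2>^s, which the weight compensates, and
   what is left is at most <xi_1>^-k <xi_2>^(-d-eps), dominated by an integrable
   product of one-dimensional functions. *)

Require Import Defs.
From HB Require Import structures.
From mathcomp Require Import all_boot all_order all_algebra.
From mathcomp Require Import complex.
From mathcomp Require Import all_classical all_reals all_analysis.
From mathcomp Require Import measurable_realfun ring lra.

Set Implicit Arguments.
Unset Strict Implicit.
Unset Printing Implicit Defensive.

Import Order.TTheory GRing.Theory Num.Theory.
Import numFieldTopology.Exports numFieldNormedType.Exports.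

Local Open Scope classical_set_scope.
Local Open Scope ring_scope.

(** The integrand of the modulation norm is a supremum over uncountably many [X], and its
    measurability is never established. The final estimate therefore rests on monotonicity of the
    integral for nonnegative functions, which needs no measurability. The decay in [xi_1] comes from
    cancellation in the inner integral. Absolute values may enter only after that integral has been
    evaluated, so the estimates against [mu] bound fibre integrals and not their integrands.
    Lebesgue measure on row vectors is defined by recursion on the dimension. Translation invariance
    and integrability are proved along this recursion, which is why brackets are compared with
    products of one-variable factors. Integration by parts is deduced from translation invariance
    instead of iterated one-dimensional integrals. Membership also requires [1 (x) mu] to be a
    tempered distribution. This takes no oscillation: decay of order [2 d] in [x] and of an integer
    order at least [s] in [xi] suffices, without derivatives. *)

Section monotone.
Import HBNNSimple.
Local Open Scope ereal_scope.
Context d (T : measurableType d) (R : realType).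
Variable m : {measure set T -> \bar R}.

(** The integral of a nonnegative function is the supremum of the integrals of the simple functions
    below it, and a simple function below [f] is also below [g]. *)
Lemma ge0_le_integral_nonmeasurable (f g : T -> \bar R) :
  (forall x, 0 <= f x) -> (forall x, f x <= g x) ->
  \int[m]_x f x <= \int[m]_x g x.
Proof.
move=> f0 fg; have g0 x : 0 <= g x by exact: le_trans (fg x).
rewrite !ge0_integralTE//; apply: ereal_sup_le => /= _ [h hf <-].
by exists h => // x; exact: le_trans (fg x).
Qed.

(** The positive and the negative part of [f] both have integral in [[0, K]], so their difference
    lies in [[-K, K]]. *)
Lemma normr_Rintegral_le (f : T -> R) (g : T -> \bar R) (K : R) :
  (forall x, `|f x|%:E <= g x) -> \int[m]_x g x <= K%:E ->
  (`|\int[m]_x f x| <= K)%R.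
Proof.
move=> fg gK.
have part (h : T -> \bar R) : (forall x, 0 <= h x) ->
    (forall x, h x <= `|f x|%:E) -> 0 <= \int[m]_x h x <= K%:E.
  move=> h0 hf; rewrite integral_ge0//=; apply: le_trans gK.
  by apply: ge0_le_integral_nonmeasurable => // x; exact: le_trans (fg x).
have /andP[p0 pK] : 0 <= \int[m]_x (EFin \o f)^\+ x <= K%:E.
  apply: part => x; first exact: funepos_ge0.
  by rewrite funeposE /= -EFin_max lee_fin ge_max ler_norm normr_ge0.
have /andP[n0 nK] : 0 <= \int[m]_x (EFin \o f)^\- x <= K%:E.
  apply: part => x; first exact: funeneg_ge0.
  by rewrite funenegE /= -EFin_max lee_fin ge_max -normrN ler_norm normr_ge0.
rewrite /Rintegral integralE -/(EFin \o f).
move: p0 pK n0 nK.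
case: (\int[m]_x (EFin \o f)^\+ x) => // p; case: (\int[m]_x (EFin \o f)^\- x) => // q.
by rewrite /= !lee_fin => p0 pK q0 qK; rewrite ler_norml; apply/andP; split; lra.
Qed.

End monotone.

(** * Borel measurability on spaces of row vectors *)

Section borel.
Variable R : realType.

Lemma measurable_to_borel_rV d (T : measurableType d) n (h : T -> borel_rV R n) :
  (forall U : set 'rV[R]_n, open U -> measurable (h @^-1` U)) ->
  measurable_fun setT h.
Proof.
move=> hU; apply: (@measurability _ _ T (borel_rV R n) _ _ (@open 'rV[R]_n) erefl).
by move=> _ [U oU <-]; rewrite setTI; exact: hU.
Qed.

Lemma measurable_to_real d (T : measurableType d) (h : T -> R) :
  (forall U : set R, open U -> measurable (h @^-1` U)) -> measurable_fun setT h.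
Proof.
move=> hU; apply: (@measurability _ _ T R _ _ _ (RGenOpens.measurableE R)).
move=> _ [U [a [b ->]] <-]; rewrite setTI; apply: hU; exact: interval_open.
Qed.

Lemma continuous_measurable_rV n (h : 'rV[R]_n -> R) : continuous h ->
  measurable_fun setT (h : borel_rV R n -> R).
Proof.
move=> ch; apply: measurable_to_real => U oU.
by apply: sub_sigma_algebra; apply: open_comp => // v _; exact: ch.
Qed.

Lemma continuous_measurable_rV_rV m n (h : 'rV[R]_m -> 'rV[R]_n) : continuous h ->
  measurable_fun setT (h : borel_rV R m -> borel_rV R n).
Proof.
move=> ch; apply: measurable_to_borel_rV => U oU.
by apply: sub_sigma_algebra; apply: open_comp => // v _; exact: ch.
Qed.

(** The product sigma-algebra is generated by rectangles, so an open set has to be exhibited as a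
    countable union of them: boxes with rational centre and radius [1 / (k + 1)]. *)
Lemma measurable_open_rV_prod m n (U : set ('rV[R]_m * 'rV[R]_n)) : open U ->
  measurable (U : set (borel_rV R m * borel_rV R n)).
Proof.
move=> oU.
pose B (t : 'rV[rat]_m * 'rV[rat]_n * nat) : set (borel_rV R m * borel_rV R n) :=
  (ball (map_mx ratr t.1.1 : 'rV[R]_m) t.2.+1%:R^-1) `*`
  (ball (map_mx ratr t.1.2 : 'rV[R]_n) t.2.+1%:R^-1).
have mB t : measurable (B t).
  by apply: measurableX; apply: sub_sigma_algebra; exact: ball_open.
suff -> : U = \bigcup_(t in [set t | B t `<=` U]) B t.
  rewrite bigcup_mkcond; apply: countable_bigcupT_measurable; first exact: countableP.
  by move=> t; case: ifP => _; [exact: mB|exact: measurable0].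
apply/seteqP; split => [[x v] Uxv|p [t tU]]; last exact: tU.
have /nbhs_ballP[e /= e0 eU] : nbhs (x, v) U by exact: open_nbhs_nbhs.
(* Radius below [e / 2]: a box centred within that distance of the point still lies in the ball of
   radius [e]. *)
have [k _ /(_ k (leqnn k)) ke] := near_infty_natSinv_lt (PosNum (divr_gt0 e0 (ltr0Sn R 1))).
have k0 : 0 < k.+1%:R^-1 :> R by rewrite invr_gt0.
have [q xq] := rat_dense_rV x k0.
have [w vw] := rat_dense_rV v k0.
exists (q, w, k); last by split; apply: ball_sym.
move=> [y z] [/= qy wz]; apply: eU; split => /=.
  by apply: le_ball (ball_triangle xq qy); rewrite (splitr e) lerD// ltW.
by apply: le_ball (ball_triangle vw wz); rewrite (splitr e) lerD// ltW.
Qed.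

Lemma row_mx_continuous m n :
  continuous (fun p : 'rV[R]_m * 'rV[R]_n => row_mx p.1 p.2).
Proof.
move=> p A /nbhs_ballP[e /= e0 eA]; apply/nbhs_ballP; exists e => // q [B1 B2].
have [_ pq1] : @mx_ball _ _ _ _ p.1 e q.1 by [].
have [_ pq2] : @mx_ball _ _ _ _ p.2 e q.2 by [].
apply: eA.
suff : @mx_ball _ _ _ _ (row_mx p.1 p.2) e (row_mx q.1 q.2) by [].
by split=> [//|i j]; rewrite !mxE; case: (fintype.split j) => k; [exact: pq1|exact: pq2].
Qed.

Lemma measurable_row_mx m n (h : 'rV[R]_(m + n) -> R) : continuous h ->
  measurable_fun setT
    (fun p : borel_rV R m * borel_rV R n => h (row_mx (p.1 : 'rV[R]_m) p.2)).
Proof.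
move=> ch; apply: measurable_to_real => U oU.
apply: measurable_open_rV_prod.
apply: (@open_comp _ _ (fun p : 'rV[R]_m * 'rV[R]_n => h (row_mx p.1 p.2))) => // p _.
apply: (@continuous_comp _ _ _ (fun p : 'rV[R]_m * 'rV[R]_n => row_mx p.1 p.2) h).
  exact: row_mx_continuous.
exact: ch.
Qed.

End borel.

(** * Translation invariance of Lebesgue measure *)

Section translation.
Variable R : realType.
Local Notation leb := (@lebesgue_measure R).

(** The pushforward of Lebesgue measure under the translation gives half-open intervals their
    length, hence equals Lebesgue measure by uniqueness. *)
Lemma ge0_integral_translate1 (f : R -> \bar R) (a : R) :
  measurable_fun setT f -> (forall x, 0 <= f x)%E ->
  (\int[leb]_x f (x + a)%R = \int[leb]_x f x)%E.
Proof.
move=> mf f0.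
have mt : measurable_fun setT ((+%R^~ a) : measurableTypeR R -> measurableTypeR R).
  by apply: measurable_funD.
transitivity (\int[pushforward leb ((+%R^~ a) : measurableTypeR R -> measurableTypeR R)]_x f x)%E.
  by rewrite (@ge0_integral_pushforward _ _ _ _ _ _ mt).
apply: eq_measure_integral => //= A mA _; apply/esym/lebesgue_measure_unique => //= _ [[b c]] _ <-.
rewrite /pushforward /= [X in _ = leb X](_ : _ = `](b - a), (c - a)]%classic); last first.
  by apply/seteqP; split => x /=; rewrite !in_itv /= ltrBlDr lerBrDr.
rewrite !lebesgue_measure_itv/= !lte_fin ltrD2r.
by case: ifPn => // _; rewrite -!EFinB; congr EFin; lra.
Qed.

(** Tonelli for the product that defines the measure in dimension [n + 1]; the inductions on the
    dimension rest on it. *)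
Lemma ge0_integral_lebesgue_succ n (f : 'rV[R]_n.+1 -> \bar R) :
  measurable_fun setT (f : borel_rV R n.+1 -> _) -> (forall x, 0 <= f x)%E ->
  (\int[lebesgue_rV R n.+1]_x f x =
   \int[leb]_t \int[lebesgue_rV R n]_v f (rV_cons (t, v)))%E.
Proof.
move=> mf f0 /=.
have -> := @ge0_integral_pushforward _ _ (measurableTypeR R * borel_rV R n)%type
  (borel_rV R n.+1) R (@rV_cons R n) (@measurable_rV_cons R n)
  (leb \x lebesgue_rV R n)%E setT f measurableT mf (fun x _ => f0 x).
rewrite preimage_setT fubini_tonelli1//.
- exact: measurableT_comp mf (@measurable_rV_cons R n).
- by move=> x; exact: f0.
Qed.

Lemma ge0_integral_translate n (f : 'rV[R]_n -> \bar R) (a : 'rV[R]_n) :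
  measurable_fun setT (f : borel_rV R n -> _) -> (forall x, 0 <= f x)%E ->
  (\int[lebesgue_rV R n]_x f (x + a)%R = \int[lebesgue_rV R n]_x f x)%E.
Proof.
elim: n f a => [|n IH] f a mf f0.
  by apply: eq_integral => x _; rewrite [(x + a)%R]thinmx0 [x in RHS]thinmx0.
have mta : measurable_fun setT
    ((fun x => x + a) : borel_rV R n.+1 -> borel_rV R n.+1).
  apply: continuous_measurable_rV_rV => x.
  by apply: (@continuousD R 'rV[R]_n.+1 'rV[R]_n.+1 id (cst a) x);
    [exact: id|exact: cst_continuous].
rewrite (ge0_integral_lebesgue_succ mf f0).
rewrite (@ge0_integral_lebesgue_succ _ (fun x => f (x + a)%R)); last 2 first.
- exact: (measurableT_comp mf mta).
- by move=> x; exact: f0.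
pose a' := (rV_uncons a).2.
(* The induction hypothesis shifts the last [n] coordinates inside; the outer integral then takes
   care of the first coordinate. *)
transitivity (\int[leb]_t \int[lebesgue_rV R n]_v f (rV_cons ((t + a ord0 ord0)%R, v)))%E.
  apply: eq_integral => t _.
  rewrite -(IH (fun v => f (rV_cons ((t + a ord0 ord0)%R, v))) a') => [||v]; last exact: f0.
    apply: eq_integral => v _; congr f; apply/rowP => i; rewrite !mxE.
    by case: unliftP => [j ->|->] //=; rewrite !mxE.
  exact: (measurableT_comp (measurableT_comp mf (@measurable_rV_cons R n))
    (@pair1_measurable _ _ (measurableTypeR R) (borel_rV R n) (t + a ord0 ord0))).
rewrite (@ge0_integral_translate1
  (fun t => \int[lebesgue_rV R n]_v f (rV_cons (t, v)))%E)//.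
  apply: (@measurable_fun_fubini_tonelli_F _ _ _ _ R (lebesgue_rV R n)
    (fun p : R * borel_rV R n => f (rV_cons p))).
    exact: measurableT_comp mf (@measurable_rV_cons R n).
  by move=> p; exact: f0.
by move=> t; exact: integral_ge0.
Qed.

End translation.

(** * Integrable product weights *)

Section weight.
Variable R : realType.
Local Notation leb := (@lebesgue_measure R).

Lemma continuous_powR_gt0 (r x : R) : 0 < x -> {for x, continuous (@powR R ^~ r)}.
Proof.
move=> x0; apply: differentiable_continuous; apply/derivable1_diffP.
by have [] := is_derive1_powR r x0.
Qed.

Lemma continuous_powR_1norm (p : R) : continuous (fun t : R => (1 + `|t|) `^ p).
Proof.
move=> t; apply: (@continuous_comp _ _ _ (fun t : R => 1 + `|t|) (@powR R ^~ p)).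
  by apply: cvgD; [exact: cvg_cst|exact: norm_continuous].
by apply: continuous_powR_gt0; rewrite ltr_pwDl.
Qed.

Lemma cvg_powRN_pinfty (c : R) : 0 < c -> (1 + t) `^ (- c) @[t --> +oo] --> 0.
Proof.
move=> c0.
apply/cvgrPdist_lt => e e0; near=> t.
have t0 : 0 < 1 + t by near: t; exists 0; split => // t /= t0; rewrite addr_gt0.
rewrite sub0r normrN ger0_norm ?powR_ge0// powRN invf_plt ?posrE ?powR_gt0//.
rewrite (_ : e^-1 = (e^-1 `^ c^-1) `^ c); last first.
  by rewrite -powRrM mulVf ?gt_eqF// powRr1// invr_ge0 ltW.
apply: gt0_ltr_powR => //; rewrite ?nnegrE ?powR_ge0 ?(ltW t0)//.
near: t; exists (e^-1 `^ c^-1); split; first exact: num_real.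
by move=> t /= h; rewrite (lt_trans h)// ltrDr.
Unshelve. all: by end_near. Qed.

(** By evenness only the half-line matters, and there [F] is a primitive vanishing at infinity.
    Taking [1 + |t|] instead of the bracket is what makes the primitive explicit. *)
Lemma integral_1norm_lty (p : R) : 1 < p ->
  (\int[leb]_t ((1 + `|t|) `^ (- p))%:E < +oo)%E.
Proof.
move=> p1.
rewrite (@ge0_symfun_integralT _ (fun t : R => (1 + `|t|) `^ (- p))); last 3 first.
- by move=> t; exact: powR_ge0.
- exact: continuous_powR_1norm.
- by move=> t /=; rewrite normrN.
rewrite (_ : [set x : R | 0 <= x] = `[0, +oo[%classic); last first.
  by apply/seteqP; split => x /=; rewrite in_itv/= andbT.
pose F (t : R) := - (p - 1)^-1 * (1 + t) `^ (- (p - 1)).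
have dF (t : R) : 0 <= t -> is_derive t 1 F ((1 + `|t|) `^ (- p)).
  move=> t0.
  have t1 : 0 < 1 + t by rewrite ltr_pwDl.
  have d1 : is_derive t (1:R) (fun u : R => 1 + u) 1.
    by rewrite -[X in is_derive _ _ _ X]add0r; exact: is_deriveD.
  have d2 := @is_derive1_comp _ (@powR R ^~ (- (p - 1))) (fun u : R => 1 + u) t _ _
    (is_derive1_powR (- (p - 1)) t1) d1.
  have d3 := is_deriveZ (- (p - 1)^-1) d2.
  apply: is_derive_eq.
  rewrite /= mulr1 ger0_norm//.
  rewrite [LHS](_ : _ = - (p - 1)^-1 * (- (p - 1) * (1 + t) `^ (- (p - 1) - 1)))//.
  rewrite mulrA mulrNN mulVf ?mul1r; last by rewrite subr_eq0 gt_eqF.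
  by congr (_ `^ _); lra.
rewrite (@ge0_continuous_FTC2y _ _ F _ 0) //.
- by rewrite -EFinB -EFinM ltry.
- by apply: continuous_subspaceT => x; exact: continuous_powR_1norm.
- rewrite -(mulr0 (- (p - 1)^-1)); apply: cvgM; first exact: cvg_cst.
  by apply: cvg_powRN_pinfty; rewrite subr_gt0.
- by move=> x x0; have [] := dF _ (ltW x0).
- apply: cvg_at_right_filter; apply: differentiable_continuous; apply/derivable1_diffP.
  by have [] := dF _ (lexx 0).
- move=> x; rewrite in_itv/= andbT => /ltW x0.
  by rewrite derive1E; have [_ ->] := dF _ x0.
Qed.

Definition weight1 (p t : R) : R := Num.sqrt (1 + t ^+ 2) `^ (- p).

Lemma weight1_ge0 p t : 0 <= weight1 p t.
Proof. exact: powR_ge0. Qed.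

Lemma sqrt1D_gt0 (x : R) : 0 <= x -> 0 < Num.sqrt (1 + x).
Proof. by move=> x0; rewrite sqrtr_gt0 ltr_pwDl. Qed.

Lemma continuous_weight1 p : continuous (weight1 p).
Proof.
move=> t; apply: (@continuous_comp _ _ _ (fun t : R => Num.sqrt (1 + t ^+ 2)) (@powR R ^~ (- p))).
  apply: (@continuous_comp _ _ _ (fun t : R => 1 + t ^+ 2) Num.sqrt).
    by apply: cvgD; [exact: cvg_cst|exact: exprn_continuous].
  exact: sqrt_continuous.
by apply: continuous_powR_gt0; exact/sqrt1D_gt0/sqr_ge0.
Qed.

(** Comparison with the previous integrand through [1 + |t| <= 2 * sqrt (1 + t^2)]; squared, the
    difference of the two sides is a sum of nonnegative terms. *)
Lemma integral_weight1_lty (p : R) : 1 < p ->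
  (\int[leb]_t (weight1 p t)%:E < +oo)%E.
Proof.
move=> p1.
apply: (@le_lt_trans _ _ (\int[leb]_t ((2 `^ p)%:E * ((1 + `|t|) `^ (- p))%:E))%E).
  apply: ge0_le_integral_nonmeasurable => t; rewrite -?EFinM lee_fin; first exact: weight1_ge0.
  have s0 := sqrt1D_gt0 (sqr_ge0 t).
  rewrite /weight1 !powRN ler_pdivlMr ?powR_gt0 ?ltr_pwDl//.
  rewrite mulrC ler_pdivrMr ?powR_gt0// -powRM ?(ltW s0)//.
  apply: ge0_ler_powR; rewrite ?nnegrE ?addr_ge0 ?mulr_ge0 ?(ltW s0) ?(ltW (lt_trans ltr01 p1))//.
  rewrite -ler_sqr ?nnegrE ?addr_ge0 ?mulr_ge0 ?(ltW s0)// exprMn sqr_sqrtr ?addr_ge0 ?sqr_ge0//.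
  have E : `|t| ^+ 2 = t ^+ 2 by rewrite real_normK ?num_real.
  rewrite -E -subr_ge0 [leRHS](_ : _ = 2 * `|t| ^+ 2 + 2 + (`|t| - 1) ^+ 2); last by ring.
  apply: addr_ge0; last exact: sqr_ge0.
  by apply: addr_ge0 => //; apply: mulr_ge0 => //; exact: sqr_ge0.
rewrite ge0_integralZl//; last first.
  by apply/measurable_EFinP; apply: continuous_measurable_fun; exact: continuous_powR_1norm.
apply: lte_mul_pinfty; rewrite ?lee_fin ?powR_ge0//.
exact: integral_1norm_lty.
Qed.

(** A product of one-variable brackets, so that [p > 1] gives integrability in every dimension by
    induction; the bracket of the whole vector does not factor. *)
Definition weight (p : R) n (x : 'rV[R]_n) : R := \prod_i weight1 p (x ord0 i).

Lemma weight_ge0 p n (x : 'rV[R]_n) : 0 <= weight p x.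
Proof. by apply: prodr_ge0 => i _; exact: weight1_ge0. Qed.

Lemma measurable_weight p n : measurable_fun setT (@weight p n : borel_rV R n -> R).
Proof.
apply: measurable_prod => i _.
apply: (@measurableT_comp _ _ _ _ _ _ (weight1 p)).
  by apply: continuous_measurable_fun; exact: continuous_weight1.
by apply: continuous_measurable_rV => x; exact: coord_continuous.
Qed.

Lemma integral_weight_lty (p : R) n : 1 < p ->
  (\int[lebesgue_rV R n]_x (weight p x)%:E < +oo)%E.
Proof.
move=> p1; elim: n => [|n IH].
  rewrite (_ : (fun x : 'rV_0 => _) = cst 1%:E); last first.
    by apply/funext => x; rewrite /weight big_ord0.
  rewrite integral_cst//= diracT mule1 ltry//.
rewrite ge0_integral_lebesgue_succ; last 2 first.
- by apply/measurable_EFinP; exact: measurable_weight.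
- by move=> x; rewrite lee_fin weight_ge0.
rewrite (_ : (fun t => _) =
    (fun t => (\int[lebesgue_rV R n]_x (weight p x)%:E) * (weight1 p t)%:E)%E); last first.
  apply/funext => t; rewrite muleC -ge0_integralZl//; last 3 first.
  - by apply/measurable_EFinP; exact: measurable_weight.
  - by move=> x _; rewrite lee_fin weight_ge0.
  - by rewrite lee_fin weight1_ge0.
  apply: eq_integral => x _; rewrite -EFinM /weight big_ord_recl !mxE unlift_none; congr (_ * _)%:E.
  by apply: eq_bigr => i _; rewrite !mxE liftK.
rewrite ge0_integralZl//; last 3 first.
- by apply/measurable_EFinP; apply: continuous_measurable_fun; exact: continuous_weight1.
- by move=> x _; rewrite lee_fin weight1_ge0.
- by apply: integral_ge0 => x _; rewrite lee_fin weight_ge0.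
apply: lte_mul_pinfty; last exact: integral_weight1_lty.
  by apply: integral_ge0 => x _; rewrite lee_fin weight_ge0.
by rewrite ge0_fin_numE//; apply: integral_ge0 => x _; rewrite lee_fin weight_ge0.
Qed.

End weight.

(** * Inequalities for the Japanese bracket *)

Section japanese_bracket.
Variable R : realType.

Lemma dotp_ge0 n (x : 'rV[R]_n) : 0 <= dotp x x.
Proof. by apply: sumr_ge0 => i _; rewrite -expr2 sqr_ge0. Qed.

Lemma japanese_sqr n (x : 'rV[R]_n) : japanese x ^+ 2 = 1 + dotp x x.
Proof. by rewrite sqr_sqrtr// addr_ge0// dotp_ge0. Qed.

Lemma japanese_gt0 n (x : 'rV[R]_n) : 0 < japanese x.
Proof. exact/sqrt1D_gt0/dotp_ge0. Qed.

Lemma japanese_ge0 n (x : 'rV[R]_n) : 0 <= japanese x.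
Proof. exact/ltW/japanese_gt0. Qed.

Lemma japanese_ge1 n (x : 'rV[R]_n) : 1 <= japanese x.
Proof.
rewrite -ler_sqr ?nnegrE ?japanese_ge0// japanese_sqr expr1n lerDl.
exact: dotp_ge0.
Qed.

Lemma dotpN n (x : 'rV[R]_n) : dotp (- x) (- x) = dotp x x.
Proof. by apply: eq_bigr => i _; rewrite !mxE mulrNN. Qed.

Lemma japaneseN n (x : 'rV[R]_n) : japanese (- x) = japanese x.
Proof. by rewrite /japanese dotpN. Qed.

(** Follows from [|x + y|^2 <= 2 |x|^2 + 2 |y|^2]. The constant 2 is generous, as constants are
    absorbed later. *)
Lemma peetre n (x y : 'rV[R]_n) :
  japanese (x + y) <= 2 * japanese x * japanese y.
Proof.
rewrite -ler_sqr ?nnegrE ?mulr_ge0 ?japanese_ge0//.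
rewrite !exprMn !japanese_sqr.
have h : dotp (x + y) (x + y) <= 2 * dotp x x + 2 * dotp y y.
  rewrite /dotp !mulr_sumr -big_split/=; apply: ler_sum => i _; rewrite !mxE.
  set a := x _ _; set b := y _ _.
  rewrite -subr_ge0 [leRHS](_ : _ = (a - b) ^+ 2) ?sqr_ge0//; ring.
have := dotp_ge0 x; have := dotp_ge0 y.
move: h; set a := dotp x x; set b := dotp y y; set c := dotp _ _ => h b0 a0.
by clearbody a b c; nra.
Qed.

Lemma sqrt_coord_le_japanese n (x : 'rV[R]_n) i :
  Num.sqrt (1 + x ord0 i ^+ 2) <= japanese x.
Proof.
rewrite ler_wsqrtr// lerD2l /dotp (bigD1 i)//= -expr2 lerDl.
by apply: sumr_ge0 => j _; rewrite -expr2 sqr_ge0.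
Qed.

(** Each one-variable bracket is at most [<x>], so each of the [n] factors of the weight is at least
    [<x>^-p]; raising the exponent to [q] only helps because [<x> >= 1]. *)
Lemma japanese_le_weight n (x : 'rV[R]_n) (p q : R) : 0 <= p -> p * n%:R <= q ->
  japanese x `^ (- q) <= weight p x.
Proof.
move=> p0 pq.
apply: (@le_trans _ _ (japanese x `^ (- (p * n%:R)))).
  by apply: ler_powR; [exact: japanese_ge1|rewrite lerN2].
rewrite -mulNr powRrM powR_mulrn ?powR_ge0// /weight.
rewrite -[X in _ ^+ X]card_ord -prodr_const.
apply: ler_prod => i _; rewrite powR_ge0/= /weight1.
have s0 := sqrt1D_gt0 (sqr_ge0 (x ord0 i)).
rewrite !powRN lef_pV2 ?posrE ?powR_gt0 ?japanese_gt0//.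
by apply: ge0_ler_powR; rewrite ?nnegrE ?sqrtr_ge0 ?japanese_ge0// sqrt_coord_le_japanese.
Qed.

Lemma japaneseV_le_weight n (x : 'rV[R]_n) (p : R) (k : nat) : 0 <= p -> p * n%:R <= k%:R ->
  japanese x ^- k <= weight p x.
Proof.
by move=> p0 pk; rewrite -powR_invn ?japanese_ge0//; exact: japanese_le_weight.
Qed.

Lemma continuous_dotp n (y : 'rV[R]_n) : continuous (fun x : 'rV[R]_n => dotp x y).
Proof.
rewrite /dotp; apply: continuous_big => [|i _ z]; first exact: add_continuous.
apply: (@continuousM R 'rV[R]_n (fun x => x ord0 i) (cst (y ord0 i)) z).
  exact: coord_continuous.
exact: cst_continuous.
Qed.

Lemma continuous_japanese n : continuous (@japanese R n).
Proof.
move=> x; apply: (@continuous_comp _ _ _ (fun x : 'rV[R]_n => 1 + dotp x x) Num.sqrt).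
  apply: (@continuousD R R 'rV[R]_n (cst 1) (fun x => dotp x x) x); first exact: cst_continuous.
  move: x; rewrite /dotp; apply: continuous_big => [|i _ z]; first exact: add_continuous.
  by apply: (@continuousM R 'rV[R]_n (fun x => x ord0 i) (fun x => x ord0 i) z);
    exact: coord_continuous.
exact: sqrt_continuous.
Qed.

Lemma dotp_row_mx m n (x x' : 'rV[R]_m) (y y' : 'rV[R]_n) :
  dotp (row_mx x y) (row_mx x' y') = dotp x x' + dotp y y'.
Proof.
rewrite /dotp big_split_ord/=; congr (_ + _); apply: eq_bigr => i _.
  by rewrite !row_mxEl.
by rewrite !row_mxEr.
Qed.

Lemma japanese_row_mxl m n (x : 'rV[R]_m) (y : 'rV[R]_n) :
  japanese x <= japanese (row_mx x y).
Proof. by rewrite ler_wsqrtr// dotp_row_mx lerD2l lerDl dotp_ge0. Qed.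

Lemma japanese_row_mxr m n (x : 'rV[R]_m) (y : 'rV[R]_n) :
  japanese y <= japanese (row_mx x y).
Proof. by rewrite ler_wsqrtr// dotp_row_mx lerD2l lerDr dotp_ge0. Qed.

Lemma japanese_row_mxV m n (x : 'rV[R]_m) (y : 'rV[R]_n) a b :
  japanese (row_mx x y) ^- (a + b) <= japanese x ^- a * japanese y ^- b.
Proof.
rewrite -invfM lef_pV2 ?posrE ?mulr_gt0 ?exprn_gt0 ?japanese_gt0// exprD.
by apply: ler_pM; rewrite ?exprn_ge0 ?japanese_ge0//; apply: lerXn2r;
  rewrite ?nnegrE ?japanese_ge0 ?japanese_row_mxl ?japanese_row_mxr.
Qed.

(** The square of the bracket has [n + 1] terms, each at most [M^2]; using [n + 1] instead of its
    square root keeps the constant free of roots. *)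
Lemma japanese_le_coord_bound n (x : 'rV[R]_n) (M : R) : 1 <= M ->
  (forall i, `|x ord0 i| <= M) -> japanese x <= n.+1%:R * M.
Proof.
move=> M1 xM; rewrite -ler_sqr ?nnegrE ?japanese_ge0 ?mulr_ge0 ?(le_trans ler01 M1)//.
rewrite japanese_sqr exprMn.
have M2 : 1 <= M ^+ 2 by rewrite exprn_ege1.
apply: (@le_trans _ _ (n.+1%:R * M ^+ 2)); last first.
  apply: ler_wpM2r; first exact: sqr_ge0.
  by rewrite expr2 ler_peMr// ler1n.
rewrite -natr1 mulrDl mul1r addrC lerD//.
rewrite mulr_natl -[X in _ *+ X]card_ord -sumr_const; apply: ler_sum => i _.
by rewrite -expr2 -(real_normK (num_real (x ord0 i))) lerXn2r ?nnegrE ?(le_trans ler01 M1).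
Qed.

End japanese_bracket.

(** * Integrals of directional derivatives vanish *)

Section vanishing_derivative.
Variables (R : realType) (n : nat).
Implicit Types (g G : 'rV[R]_n -> R) (e : 'rV[R]_n).
Local Notation leb := (lebesgue_rV R n).

Lemma continuous_translate g e : continuous g -> continuous (fun x : 'rV[R]_n => g (x + e)).
Proof.
move=> cg x; apply: (@continuous_comp _ _ _ (fun x : 'rV[R]_n => x + e) g).
  by apply: (@continuousD R 'rV[R]_n 'rV[R]_n id (cst e) x); [exact: id|exact: cst_continuous].
exact: cg.
Qed.

Lemma Rintegral_translate g e : continuous g ->
  \int[leb]_x g (x + e) = \int[leb]_x g x.
Proof.
move=> cg; rewrite /Rintegral; congr fine.
have mg : measurable_fun setT (EFin \o g : borel_rV R n -> _).
  by apply/measurable_EFinP; exact: continuous_measurable_rV.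
rewrite integralE [in RHS]integralE; congr (_ - _)%E.
  rewrite -[RHS](ge0_integral_translate e) => [||x]; last exact: funepos_ge0.
    by apply: eq_integral => x _; rewrite !funeposE.
  exact: measurable_funepos.
rewrite -[RHS](ge0_integral_translate e) => [||x]; last exact: funeneg_ge0.
  by apply: eq_integral => x _; rewrite !funenegE.
exact: measurable_funeneg.
Qed.

Lemma integrable_weight (p C : R) : 1 < p ->
  (leb).-integrable setT (fun x => (C * weight p x)%:E).
Proof.
move=> p1; under eq_fun do rewrite EFinM.
apply: integrableZl => //; apply/integrableP; split.
  by apply/measurable_EFinP; exact: measurable_weight.
under eq_integral => x _ do rewrite gee0_abs ?lee_fin ?weight_ge0//.
exact: integral_weight_lty.
Qed.

(** Decay of order [2 n] leaves exponent 2 for each of the [n] coordinates, and 2 exceeds the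
    critical exponent 1. *)
Lemma integrable_decay g (C : R) (k : nat) : (n + n <= k)%N -> continuous g ->
  (forall x, `|g x| <= C * japanese x ^- k) ->
  (leb).-integrable setT (EFin \o g).
Proof.
move=> nk cg gC.
have C0 : 0 <= C.
  have := le_trans (normr_ge0 _) (gC 0).
  by rewrite pmulr_lge0// invr_gt0 exprn_gt0// japanese_gt0.
apply: (@le_integrable _ (borel_rV R n) R leb setT measurableT (EFin \o g)
  (fun x : 'rV[R]_n => (C * weight 2 x)%:E)).
- by apply/measurable_EFinP; exact: continuous_measurable_rV.
- move=> x _ /=; rewrite lee_fin (le_trans (gC x))// ger0_norm ?mulr_ge0 ?weight_ge0//.
  apply: ler_wpM2l => //; apply: japaneseV_le_weight => //.
  by rewrite -natrM ler_nat mul2n -addnn.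
- by apply: integrable_weight; rewrite ltr1n.
Qed.

(** Restriction to a line makes the one-variable mean value theorem and chain rule available for
    directional derivatives; the converse passage follows. *)
Lemma is_derive_line G e x t : derivable G (t *: e + x) e ->
  is_derive t (1 : R) (fun u : R => G (u *: e + x)) ('D_e G (t *: e + x)).
Proof.
have E : (fun h : R => h^-1 *:
      (((fun u : R => G (u *: e + x)) \o shift t) (h *: (1 : R)) - G (t *: e + x))) =
    (fun h : R => h^-1 *: ((G \o shift (t *: e + x)) (h *: e) - G (t *: e + x))).
  by apply/funext => h /=; rewrite [h *: 1]mulr1 scalerDl addrA.
move=> dG; split; first by rewrite /derivable E.
by rewrite /derive E.
Qed.

Lemma is_derive_of_line G e x (df : R) :
  is_derive (0 : R) 1 (fun u : R => G (u *: e + x)) df -> is_derive x e G df.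
Proof.
have E : (fun h : R => h^-1 *:
      (((fun u : R => G (u *: e + x)) \o shift 0) (h *: (1 : R)) - G (0 *: e + x))) =
    (fun h : R => h^-1 *: ((G \o shift x) (h *: e) - G x)).
  by apply/funext => h /=; rewrite [h *: 1]mulr1 addr0 scale0r add0r.
move=> [dG <-]; split; first by move: dG; rewrite /derivable E.
by rewrite /derive E.
Qed.

(** Mean value theorem on [[0, h]]. The derivative is bounded on the fixed range [|t| <= 1], so that
    the bound does not depend on [h]. *)
Lemma increment_le G e x (h B : R) : 0 < h <= 1 -> (forall y, derivable G y e) ->
  (forall t, `|t| <= 1 -> `|'D_e G (t *: e + x)| <= B) ->
  `|h^-1 * (G (h *: e + x) - G x)| <= B.
Proof.
move=> /andP[h0 h1] dG DB.
have dl t := is_derive_line (dG (t *: e + x)).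
have cl : {within `[0, h], continuous (fun u : R => G (u *: e + x))}.
  apply: continuous_subspaceT => t; apply: differentiable_continuous.
  by apply/derivable1_diffP; have [] := dl t.
have [c] := MVT h0 (fun t _ => dl t) cl.
rewrite in_itv/= => /andP[c0 ch]; rewrite scale0r add0r subr0 => ->.
rewrite mulrCA mulVf ?gt_eqF// mulr1; apply: DB.
by rewrite gtr0_norm// (le_trans (ltW ch)).
Qed.

Lemma japanese_scale_le e (t : R) : `|t| <= 1 -> japanese (t *: e) <= japanese e.
Proof.
move=> t1; rewrite ler_wsqrtr// lerD2l; apply: ler_sum => i _; rewrite !mxE.
rewrite -!expr2 exprMn ler_piMl ?sqr_ge0//.
by rewrite -(real_normK (num_real t)) expr_le1.
Qed.

(** Peetre's inequality for [x = (t *: e + x) - t *: e], made uniform in [t]: it carries a decay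
    bound from the shifted point back to [x]. *)
Lemma japaneseV_translate e x (t : R) (k : nat) : `|t| <= 1 ->
  japanese (t *: e + x) ^- k <= (2 * japanese e) ^+ k * japanese x ^- k.
Proof.
move=> t1.
rewrite ler_pdivlMr ?exprn_gt0 ?japanese_gt0// ler_pdivrMl ?exprn_gt0 ?japanese_gt0//.
rewrite -exprMn lerXn2r ?nnegrE ?mulr_ge0 ?japanese_ge0//.
have := peetre (t *: e + x) (- (t *: e)).
rewrite addrAC subrr add0r japaneseN => /le_trans; apply.
rewrite mulrAC mulrC; apply: ler_wpM2l; first exact: japanese_ge0.
by apply: ler_wpM2l => //; exact: japanese_scale_le.
Qed.

(* The difference quotients of [G] along [e] integrate to 0 by translation
   invariance and are dominated, by the mean value theorem. *)
Lemma Rintegral_derive_eq0 G e (C : R) (k : nat) : (n + n <= k)%N ->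
  (forall x, derivable G x e) -> continuous G -> continuous ('D_e G) ->
  (forall x, `|G x| <= C * japanese x ^- k) ->
  (forall x, `|'D_e G x| <= C * japanese x ^- k) ->
  \int[leb]_x 'D_e G x = 0.
Proof.
move=> nk dG cG cDG GC DC.
have C0 : 0 <= C.
  have := le_trans (normr_ge0 _) (GC 0).
  by rewrite pmulr_lge0// invr_gt0 exprn_gt0// japanese_gt0.
pose h (m : nat) : R := m.+1%:R^-1.
have h01 m : 0 < h m <= 1 by rewrite /h invr_gt0 ltr0Sn invf_le1// ler1n.
pose q m x := (h m)^-1 * (G (h m *: e + x) - G x).
have cq m : continuous (q m).
  move=> x; apply: (@continuousM R 'rV[R]_n (cst (h m)^-1) (fun x => G (h m *: e + x) - G x) x).
    exact: cst_continuous.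
  apply: (@continuousB R R 'rV[R]_n (fun x => G (h m *: e + x)) G x); last exact: cG.
  rewrite (_ : (fun x => G (h m *: e + x)) = (fun x => G (x + h m *: e))).
    exact: continuous_translate.
  by apply/funext => y; rewrite addrC.
have int_q m : (\int[leb]_x (q m x)%:E = 0)%E.
  have iG := integrable_decay nk cG GC.
  have iGt : (leb).-integrable setT (EFin \o (fun x => G (x + h m *: e))).
    apply: (@integrable_decay _ (C * (2 * japanese e) ^+ k) k nk).
      exact: continuous_translate.
    move=> x; apply: (le_trans (GC _)); rewrite -mulrA; apply: ler_wpM2l => //.
    rewrite addrC; apply: japaneseV_translate.
    by have /andP[h0 h1] := h01 m; rewrite gtr0_norm.
  transitivity (\int[leb]_x ((h m)^-1 * (G (x + h m *: e) - G x)))%:E.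
    rewrite /Rintegral fineK.
      by apply: eq_integral => x _; rewrite /q [x + _]addrC.
    apply: integrable_fin_num => //; under eq_fun do rewrite EFinM.
    by apply: integrableZl => //; under eq_fun do rewrite EFinB; exact: integrableB.
  rewrite RintegralZl//; last by rewrite /comp; under eq_fun do rewrite EFinB; exact: integrableB.
  by rewrite RintegralB// Rintegral_translate// subrr mulr0.
pose B := C * (2 * japanese e) ^+ k.
have := @dominated_convergence _ _ _ leb setT measurableT (fun m x => (q m x)%:E)
  (EFin \o 'D_e G) (fun x => (B * weight 2 x)%:E).
case.
- by move=> m; apply/measurable_EFinP; exact: continuous_measurable_rV.
- by apply/measurable_EFinP; exact: continuous_measurable_rV.
- apply/aeW => x _; apply: cvg_EFin; first by near=> m.
  have := dG x; rewrite /derivable => /cvgr_dnbhsP/(_ h); apply.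
  split; first by move=> m; rewrite gt_eqF//; have /andP[] := h01 m.
  exact: cvg_harmonic.
- by apply: integrable_weight; rewrite ltr1n.
- apply/aeW => x m _; rewrite lee_fin.
  apply: increment_le => // t t1; apply: (le_trans (DC _)).
  rewrite /B -mulrA; apply: ler_wpM2l => //.
  apply: (le_trans (japaneseV_translate e x k t1)).
  apply: ler_wpM2l; first by rewrite exprn_ge0// mulr_ge0// japanese_ge0.
  by apply: japaneseV_le_weight => //; rewrite -natrM ler_nat mul2n -addnn.
move=> _ _; rewrite [X in X @ _ --> _](_ : _ = cst 0%E); last by apply/funext => m; exact: int_q.
by move=> /cvg_lim => /(_ (@ereal_hausdorff R)); rewrite lim_cst// /Rintegral => <-.
Unshelve. all: by end_near. Qed.

End vanishing_derivative.

(** * Oscillatory integrals and integration by parts *)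

Section oscillatory.
Variables (R : realType) (n : nat).
Implicit Types (g : 'rV[R]_n -> R) (e xi : 'rV[R]_n).
Local Notation leb := (lebesgue_rV R n).

(* The phase [th] is arbitrary so that a single family, stable under
   integration by parts, contains both the cosine and the sine transform. *)
Definition osc xi (th : R) g : R := \int[leb]_x (cos (dotp x xi + th) * g x).

Lemma normr_cos_le1 (x : R) : `|cos x| <= 1.
Proof. by rewrite ler_norml cos_geN1 cos_le1. Qed.

Lemma normr_sin_le1 (x : R) : `|sin x| <= 1.
Proof. by rewrite ler_norml sin_geN1 sin_le1. Qed.

Lemma dotpDl (x y z : 'rV[R]_n) : dotp (x + y) z = dotp x z + dotp y z.
Proof. by rewrite /dotp -big_split/=; apply: eq_bigr => i _; rewrite mxE mulrDl. Qed.

Lemma dotpZl (c : R) (x y : 'rV[R]_n) : dotp (c *: x) y = c * dotp x y.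
Proof. by rewrite /dotp mulr_sumr; apply: eq_bigr => i _; rewrite mxE mulrA. Qed.

Lemma continuous_phase (f : R -> R) xi th : continuous f ->
  continuous (fun x : 'rV[R]_n => f (dotp x xi + th)).
Proof.
move=> cf x; apply: (@continuous_comp _ _ _ (fun x : 'rV[R]_n => dotp x xi + th) f).
  apply: (@continuousD R R 'rV[R]_n (fun x => dotp x xi) (cst th) x).
    exact: continuous_dotp.
  exact: cst_continuous.
exact: cf.
Qed.

Lemma is_derive_sin_phase xi th e x :
  is_derive x e (fun x : 'rV[R]_n => sin (dotp x xi + th))
    (cos (dotp x xi + th) * dotp e xi).
Proof.
apply: is_derive_of_line.
rewrite (_ : (fun u : R => _) =
    (@sin R) \o (fun u : R => dotp e xi *: u + (dotp x xi + th))); last first.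
  by apply/funext => u /=; rewrite dotpDl dotpZl addrA [X in X + _ + _]mulrC.
rewrite -[X in cos X]add0r -[X in cos (X + _)](scaler0 _ (dotp e xi)).
apply: is_derive1_comp.
rewrite -[X in is_derive _ _ _ X]addr0; apply: is_deriveD.
by rewrite -[X in is_derive _ _ _ X]mulr1; exact: is_deriveZ.
Qed.

Lemma phase_decay (f : R -> R) xi th g (C : R) k : (forall t, `|f t| <= 1) ->
  (forall x, `|g x| <= C * japanese x ^- k) ->
  forall x, `|f (dotp x xi + th) * g x| <= C * japanese x ^- k.
Proof.
move=> f1 gC x; apply: le_trans (gC x); rewrite normrM.
by rewrite ler_piMl.
Qed.

Lemma integrable_phase (f : R -> R) xi th g (C : R) k : (n + n <= k)%N ->
  continuous f -> (forall t, `|f t| <= 1) -> continuous g ->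
  (forall x, `|g x| <= C * japanese x ^- k) ->
  leb.-integrable setT (fun x => (f (dotp x xi + th) * g x)%:E).
Proof.
move=> nk cf f1 cg gC.
apply: (@integrable_decay _ _ (fun x => f (dotp x xi + th) * g x) C k nk).
  move=> x; apply: (@continuousM R 'rV[R]_n (fun x => f (dotp x xi + th)) g x).
    exact: continuous_phase.
  exact: cg.
exact: phase_decay.
Qed.

(** The derivative along [e] of [sin (dotp x xi + th) * g x] integrates to 0. Its two terms give the
    two sides, as [- sin t = cos (t + pi / 2)]. *)
Lemma osc_by_parts xi th g e (C : R) k : (n + n <= k)%N ->
  (forall x, derivable g x e) -> continuous g -> continuous ('D_e g) ->
  (forall x, `|g x| <= C * japanese x ^- k) ->
  (forall x, `|'D_e g x| <= C * japanese x ^- k) ->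
  dotp e xi * osc xi th g = osc xi (th + pi / 2) ('D_e g).
Proof.
move=> nk dg cg cDg gC DgC.
pose H x := sin (dotp x xi + th) * g x.
have dH x : is_derive x e H
    (dotp e xi * (cos (dotp x xi + th) * g x) + sin (dotp x xi + th) * 'D_e g x).
  have := is_deriveM (is_derive_sin_phase xi th e x) (derivableP (dg x)).
  rewrite [X in is_derive _ _ _ X](_ : _ = dotp e xi * (cos (dotp x xi + th) * g x) +
    sin (dotp x xi + th) * 'D_e g x); first by [].
  rewrite addrC; congr (_ + _); rewrite /GRing.scale/=; ring.
have DH : 'D_e H = (fun x => dotp e xi * (cos (dotp x xi + th) * g x) +
    sin (dotp x xi + th) * 'D_e g x).
  by apply/funext => x; have [] := dH x.
have icos := integrable_phase xi th nk (@continuous_cos R) normr_cos_le1 cg gC.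
have isin := integrable_phase xi th nk (@continuous_sin R) normr_sin_le1 cDg DgC.
have cM (f : R -> R) h : continuous f -> continuous h ->
    continuous (fun x => f (dotp x xi + th) * h x).
  move=> cf ch x; apply: (@continuousM R 'rV[R]_n (fun x => f (dotp x xi + th)) h x).
    exact: continuous_phase.
  exact: ch.
have C0 : 0 <= C.
  have := le_trans (normr_ge0 _) (gC 0).
  by rewrite pmulr_lge0// invr_gt0 exprn_gt0// japanese_gt0.
(* A single constant must dominate both [H], bounded with [C], and its derivative, bounded with
   [|dotp e xi| * C + C]. *)
have := @Rintegral_derive_eq0 R n H e ((`|dotp e xi| + 1) * C) k nk.
rewrite DH RintegralD//; last first.
  by rewrite /comp; under eq_fun do rewrite EFinM; exact: integrableZl.
rewrite RintegralZl// -/(osc xi th g) => /(_ _ _ _ _ _)/eqP.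
rewrite addr_eq0 => h; rewrite (eqP (h _ _ _ _ _)).
- rewrite -mulN1r -RintegralZl//; apply: eq_Rintegral => x _.
  by rewrite addrA cosDpihalf mulrA mulN1r.
- by move=> x; have [] := dH x.
- exact: cM (@continuous_sin R) cg.
- move=> x; apply: (@continuousD R R 'rV[R]_n
    (fun x => dotp e xi * (cos (dotp x xi + th) * g x))
    (fun x => sin (dotp x xi + th) * 'D_e g x) x); last exact: cM (@continuous_sin R) cDg x.
  apply: (@continuousM R 'rV[R]_n (cst (dotp e xi)) (fun x => cos (dotp x xi + th) * g x) x).
    exact: cst_continuous.
  exact: cM (@continuous_cos R) cg x.
- move=> x; apply: le_trans (phase_decay _ _ normr_sin_le1 gC x) _.
  apply: ler_wpM2r; first by rewrite invr_ge0 exprn_ge0// japanese_ge0.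
  by rewrite ler_peMl// lerDr.
- move=> x; have [_ ->] := dH x; apply: le_trans (ler_normD _ _) _; rewrite mulrDl mul1r mulrDl.
  apply: lerD; last exact: phase_decay normr_sin_le1 DgC x.
  rewrite normrM -mulrA; apply: ler_wpM2l => //.
  exact: phase_decay normr_cos_le1 gC x.
Qed.

Definition weight_mass : R := fine (\int[leb]_x (weight 2 x)%:E).

Lemma weight_mass_ge0 : 0 <= weight_mass.
Proof. by apply/fine_ge0/integral_ge0 => x _; rewrite lee_fin weight_ge0. Qed.

Lemma normr_Rintegral_decay g (B : R) k : (n + n <= k)%N -> 0 <= B ->
  (forall x, `|g x| <= B * japanese x ^- k) -> `|\int[leb]_x g x| <= B * weight_mass.
Proof.
move=> nk B0 gB.
apply: (@normr_Rintegral_le _ _ _ leb g (fun x : 'rV[R]_n => (B * weight 2 x)%:E)).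
  move=> x; rewrite lee_fin; apply: (le_trans (gB x)); apply: ler_wpM2l => //.
  by apply: japaneseV_le_weight => //; rewrite -natrM ler_nat mul2n -addnn.
under eq_integral do rewrite EFinM.
rewrite ge0_integralZl//; last 2 first.
- by apply/measurable_EFinP; exact: measurable_weight.
- by move=> x _; rewrite lee_fin weight_ge0.
rewrite EFinM /weight_mass fineK// ge0_fin_numE; first by apply: integral_weight_lty; rewrite ltr1n.
by apply: integral_ge0 => x _; rewrite lee_fin weight_ge0.
Qed.

Lemma osc_le xi th g (B : R) k : (n + n <= k)%N -> 0 <= B ->
  (forall x, `|g x| <= B * japanese x ^- k) -> `|osc xi th g| <= B * weight_mass.
Proof.
move=> nk B0 gB; apply: (normr_Rintegral_decay nk B0).
exact: phase_decay normr_cos_le1 gB.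
Qed.

End oscillatory.

(** * Rapid decay of oscillatory integrals of Schwartz slices *)

Section slices.
Variables (R : realType) (d : nat).
Implicit Types (G : 'rV[R]_(d + d) -> R) (eta xi : 'rV[R]_d).

(** The Schwartz conditions on a real or imaginary part, stated as pointwise bounds with real
    constants instead of extended suprema. *)
Definition real_schwartz m (G : 'rV[R]_m -> R) : Prop :=
  (forall s x, differentiable (pderiv s G) x) /\
  (forall k s, exists2 C : R, 0 <= C & forall x, `|pderiv s G x| <= C * japanese x ^- k).

Lemma bounded_of_ereal_sup_lty (T : Type) (F : T -> R) (x0 : T) : (forall x, 0 <= F x) ->
  (ereal_sup [set (F x)%:E | x in [set: T]] < +oo)%E ->
  exists2 C : R, 0 <= C & forall x, F x <= C.
Proof.
move=> F0; set S := ereal_sup _ => Soo.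
have FS x : ((F x)%:E <= S)%E by apply: ereal_sup_ubound; exists x.
have S0 : (0 <= S)%E by apply: le_trans (FS x0); rewrite lee_fin.
exists (fine S); first exact: fine_ge0.
by move=> x; rewrite -lee_fin fineK// ge0_fin_numE.
Qed.

Local Notation normc := ComplexField.Normc.normc.

Lemma normr_Re_le (z : R[i]) : `|complex.Re z| <= normc z.
Proof. by case: z => a b /=; rewrite -sqrtr_sqr ler_wsqrtr// lerDl sqr_ge0. Qed.

Lemma normr_Im_le (z : R[i]) : `|complex.Im z| <= normc z.
Proof. by case: z => a b /=; rewrite -sqrtr_sqr ler_wsqrtr// lerDr sqr_ge0. Qed.

Lemma normc_le (z : R[i]) : normc z <= `|complex.Re z| + `|complex.Im z|.
Proof.
case: z => a b /=; rewrite -ler_sqr ?nnegrE ?sqrtr_ge0 ?addr_ge0//.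
rewrite sqr_sqrtr ?addr_ge0 ?sqr_ge0// sqrrD !real_normK ?num_real//.
by rewrite lerD2r lerDl mulrn_wge0// mulr_ge0.
Qed.

Lemma normc_ge0 (z : R[i]) : 0 <= normc z.
Proof. by case: z => a b /=; rewrite sqrtr_ge0. Qed.

Lemma schwartz_Cpderiv m (f : 'rV[R]_m -> R[i]) k s : schwartz f ->
  exists2 C : R, 0 <= C & forall x, normc (Cpderiv s f x) <= C * japanese x ^- k.
Proof.
move=> [_ /(_ k s)] /(bounded_of_ereal_sup_lty 0)[x|C C0 H].
  by rewrite mulr_ge0 ?normc_ge0// exprn_ge0// japanese_ge0.
exists C => // x; rewrite ler_pdivlMr ?exprn_gt0 ?japanese_gt0// mulrC; exact: H.
Qed.

Lemma schwartz_Re m (f : 'rV[R]_m -> R[i]) : schwartz f -> real_schwartz (@complex.Re R \o f).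
Proof.
move=> sf; split; first by move=> s x; have [] := sf.1 s x.
move=> k s; have [C C0 H] := schwartz_Cpderiv k s sf.
by exists C => // x; exact: le_trans (normr_Re_le (Cpderiv s f x)) (H x).
Qed.

Lemma schwartz_Im m (f : 'rV[R]_m -> R[i]) : schwartz f -> real_schwartz (@complex.Im R \o f).
Proof.
move=> sf; split; first by move=> s x; have [] := sf.1 s x.
move=> k s; have [C C0 H] := schwartz_Cpderiv k s sf.
by exists C => // x; exact: le_trans (normr_Im_le (Cpderiv s f x)) (H x).
Qed.

Lemma real_schwartz_continuous m (G : 'rV[R]_m -> R) s :
  real_schwartz G -> continuous (pderiv s G).
Proof. by move=> [dG _] x; exact/differentiable_continuous/dG. Qed.

Definition slice eta G : 'rV[R]_d -> R := fun y => G (row_mx y eta).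

Lemma continuous_slice eta G : continuous G -> continuous (slice eta G).
Proof.
move=> cG x; apply: (@continuous_comp _ _ _ (fun y : 'rV[R]_d => row_mx y eta) G).
  move=> A /nbhs_ballP[e /= e0 eA]; apply/nbhs_ballP; exists e => // y [_ xy]; apply: eA.
  suff : @mx_ball _ _ _ _ (row_mx x eta) e (row_mx y eta) by [].
  by split=> [//|i j]; rewrite !mxE; case: (fintype.split j) => k; [exact: xy|exact: ballxx].
exact: cG.
Qed.

(** Stated for the shifted values that enter the difference quotient, so that derivability and the
    value of the derivative both transfer by rewriting. *)
Lemma slice_quotient eta G (j : 'I_d) y (h : R) :
  (slice eta G \o shift y) (h *: (delta_mx ord0 j : 'rV[R]_d)) =
  (G \o shift (row_mx y eta)) (h *: (delta_mx ord0 (lshift d j) : 'rV[R]_(d + d))).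
Proof.
rewrite /slice /=; congr G.
by rewrite delta_mx_lshift scale_row_mx scaler0 add_row_mx add0r.
Qed.

Lemma derive_slice eta G (j : 'I_d) y :
  'D_(delta_mx ord0 j : 'rV[R]_d) (slice eta G) y =
  'D_(delta_mx ord0 (lshift d j) : 'rV[R]_(d + d)) G (row_mx y eta).
Proof. by rewrite /derive; under eq_fun do rewrite slice_quotient. Qed.

Lemma derivable_slice eta G (j : 'I_d) y :
  derivable G (row_mx y eta) (delta_mx ord0 (lshift d j) : 'rV[R]_(d + d)) ->
  derivable (slice eta G) y (delta_mx ord0 j : 'rV[R]_d).
Proof. by rewrite /derivable; under [in X in _ -> X]eq_fun do rewrite slice_quotient. Qed.

Lemma dotp_delta n (j : 'I_n) (x : 'rV[R]_n) : dotp (delta_mx ord0 j) x = x ord0 j.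
Proof.
rewrite /dotp (bigD1 j)//= big1 ?addr0; first by rewrite mxE !eqxx mul1r.
by move=> i ij; rewrite mxE eqxx (negbTE ij) mul0r.
Qed.

(** Decay of order [k + M] in the joint bracket is shared out: [k] to the integration variable [y],
    [M] to the parameter [eta]. *)
Lemma slice_decay G k M s : real_schwartz G ->
  exists2 C : R, 0 <= C & forall eta y,
    `|slice eta (pderiv s G) y| <= C * japanese eta ^- M * japanese y ^- k.
Proof.
move=> [_ /(_ (k + M)%N s)[C C0 H]]; exists C => // eta y.
apply: (le_trans (H _)); rewrite -mulrA; apply: ler_wpM2l => //.
by rewrite mulrC; exact: japanese_row_mxV.
Qed.

Lemma osc_slice_step G s xi th eta (j : 'I_d) : real_schwartz G ->
  xi ord0 j * osc xi th (slice eta (pderiv s G)) =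
  osc xi (th + pi / 2) (slice eta (pderiv (lshift d j :: s) G)).
Proof.
move=> sG.
have E : slice eta (pderiv (lshift d j :: s) G) =
    'D_(delta_mx ord0 j : 'rV[R]_d) (slice eta (pderiv s G)).
  by apply/funext => y; rewrite derive_slice.
(* The identity concerns a fixed [eta], so no decay in that variable is requested: order 0. *)
have [C1 C10 H1] := slice_decay (d + d) 0 s sG.
have [C2 C20 H2] := slice_decay (d + d) 0 (lshift d j :: s) sG.
rewrite E -dotp_delta; apply: (@osc_by_parts _ _ _ _ _ _ (C1 + C2) _ (leqnn (d + d))).
- by move=> x; apply: derivable_slice; apply: diff_derivable; exact: sG.1.
- by apply: continuous_slice; exact: real_schwartz_continuous.
- by rewrite -E; apply: continuous_slice; exact: real_schwartz_continuous.
- move=> x; apply: (le_trans (H1 eta x)); rewrite expr0 invr1 mulr1.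
  by apply: ler_wpM2r; [rewrite invr_ge0 exprn_ge0// japanese_ge0|rewrite lerDl].
- move=> x; have := H2 eta x; rewrite E expr0 invr1 mulr1 => /le_trans; apply.
  by apply: ler_wpM2r; [rewrite invr_ge0 exprn_ge0// japanese_ge0|rewrite lerDr].
Qed.

(** Each step adds [pi / 2] to the phase. It is left existential because the bounds applied to it
    are uniform in the phase. *)
Lemma osc_slice_iter G xi th eta (j : 'I_d) N : real_schwartz G ->
  exists th', xi ord0 j ^+ N * osc xi th (slice eta G) =
    osc xi th' (slice eta (pderiv (nseq N (lshift d j)) G)).
Proof.
move=> sG; elim: N => [|N [th' IH]]; first by exists th; rewrite expr0 mul1r.
by exists (th' + pi / 2); rewrite exprS -mulrA IH osc_slice_step.
Qed.

(** The maximum is one of the compared numbers, so no maximising index has to be chosen; the default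
    1 also covers the empty row. *)
Lemma bigmax_normr_ind n (P : R -> Prop) (x : 'rV[R]_n) :
  P 1 -> (forall i, P `|x ord0 i|) -> P (\big[Num.max/1]_i `|x ord0 i|).
Proof.
move=> P1 Px; elim/big_ind: _ => // a b Pa Pb.
by rewrite /Num.max; case: ifP.
Qed.

(** With [m] the maximum of 1 and the [|xi_j|], one has [<xi> <= (d + 1) m], so it is enough to
    bound [m^N] times the integral. If [m = 1] this is the direct estimate; if [m = |xi_j|], one
    integrates by parts [N] times in direction [j]. *)
Lemma osc_slice_decay G N M : real_schwartz G ->
  exists2 K : R, 0 <= K & forall xi th eta,
    `|osc xi th (slice eta G)| <= K * japanese xi ^- N * japanese eta ^- M.
Proof.
move=> sG.
have [C0 C00 H0] := slice_decay (d + d) M [::] sG.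
have /choice[C HC] : forall j : 'I_d, exists C : R, 0 <= C /\ forall eta y,
    `|slice eta (pderiv (nseq N (lshift d j)) G) y| <=
    C * japanese eta ^- M * japanese y ^- (d + d).
  by move=> j; have [C ? ?] := slice_decay (d + d) M (nseq N (lshift d j)) sG; exists C.
(* The sum makes one constant serve the case without derivatives and every direction [j] at once. *)
pose K := (C0 + \sum_j C j) * weight_mass R d.
have SC : 0 <= \sum_j C j by apply: sumr_ge0 => j _; have [] := HC j.
have K0 : 0 <= K by rewrite mulr_ge0 ?weight_mass_ge0 ?addr_ge0.
exists (d.+1%:R ^+ N * K); first by rewrite mulr_ge0 ?exprn_ge0.
move=> xi th eta.
set A := `|_|; set J := japanese eta ^- M.
have J0 : 0 <= J by rewrite invr_ge0 exprn_ge0// japanese_ge0.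
pose m := \big[Num.max/1]_i `|xi ord0 i|.
have mA : m ^+ N * A <= K * J.
  apply: (@bigmax_normr_ind _ (fun t => t ^+ N * A <= K * J)) => [|j].
    rewrite expr1n mul1r; apply: (le_trans (@osc_le _ _ _ _ _ (C0 * J) _ (leqnn (d + d)) _ _)).
    - by rewrite mulr_ge0.
    - exact: H0.
    - rewrite mulrAC; apply: ler_wpM2r => //; apply: ler_wpM2r; first exact: weight_mass_ge0.
      by rewrite lerDl.
  have [Cj0 Hj] := HC j.
  have [th' E] := osc_slice_iter xi th eta j N sG.
  rewrite -normrX -normrM E.
  apply: (le_trans (@osc_le _ _ _ _ _ (C j * J) _ (leqnn (d + d)) _ _)).
  - by rewrite mulr_ge0.
  - exact: Hj.
  - rewrite mulrAC; apply: ler_wpM2r => //; apply: ler_wpM2r; first exact: weight_mass_ge0.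
    rewrite (bigD1 j)//= addrCA lerDl addr_ge0//.
    by apply: sumr_ge0 => i _; have [] := HC i.
have m1 : 1 <= m by rewrite /m; apply: bigmax_ge_id.
have xm i : `|xi ord0 i| <= m by apply: le_bigmax.
have JN : japanese xi ^+ N <= d.+1%:R ^+ N * m ^+ N.
  rewrite -exprMn lerXn2r ?nnegrE ?mulr_ge0 ?japanese_ge0 ?(le_trans ler01 m1)//.
  exact: japanese_le_coord_bound.
rewrite mulrAC ler_pdivlMr ?exprn_gt0 ?japanese_gt0// mulrC.
apply: (@le_trans _ _ (d.+1%:R ^+ N * m ^+ N * A)).
  by apply: ler_wpM2r => //; exact: normr_ge0.
by rewrite -[leLHS]mulrA -[leRHS]mulrA; apply: ler_wpM2l; [rewrite exprn_ge0|exact: mA].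
Qed.

End slices.

(** * The pairing with [1 (x) mu] as a tempered distribution *)

Section tensor.
Variables (R : realType) (d : nat).
Variable mu : {measure set (borel_rV R d) -> \bar R}.
Variables (s : R) (M : nat).
Hypotheses (s_ge0 : 0 <= s) (sM : s <= M%:R) (mu_s : tempered_of_order mu s).
Implicit Types h : 'rV[R]_(d + d) -> R.
Local Notation leb := (lebesgue_rV R d).
Local Notation normc := ComplexField.Normc.normc.

Definition fibre_integral h (xi : 'rV[R]_d) : R := \int[leb]_x h (row_mx x xi).

Definition real_tensor h : R := \int[mu]_xi fibre_integral h xi.

(** Order [d + d] in [x] makes the fibre integrals converge; order [M >= s] in [xi] makes them
    integrable against [mu]. *)
Definition fibre_decay h (C : R) := forall x xi : 'rV[R]_d,
  `|h (row_mx x xi)| <= C * japanese xi ^- M * japanese x ^- (d + d).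

Definition moment : R := fine (\int[mu]_xi (japanese xi `^ (- s))%:E).

Lemma moment_ge0 : 0 <= moment.
Proof. by apply/fine_ge0/integral_ge0 => x _; rewrite lee_fin powR_ge0. Qed.

Lemma momentE : (\int[mu]_xi (japanese xi `^ (- s))%:E)%E = moment%:E.
Proof.
rewrite /moment fineK// ge0_fin_numE//.
by apply: integral_ge0 => x _; rewrite lee_fin powR_ge0.
Qed.

Lemma measurable_japanese_powR (r : R) :
  measurable_fun setT ((fun x => japanese x `^ r) : borel_rV R d -> R).
Proof.
apply: continuous_measurable_rV => x.
apply: (@continuous_comp _ _ _ (@japanese R d) (@powR R ^~ r)).
  exact: continuous_japanese.
by apply: continuous_powR_gt0; exact: japanese_gt0.
Qed.

(** Tonelli gives measurability of partial integrals of nonnegative functions, hence the separate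
    treatment of positive and negative parts. *)
Lemma measurable_fibre_integral h : continuous h ->
  measurable_fun setT (fibre_integral h : borel_rV R d -> R).
Proof.
move=> ch; rewrite /fibre_integral /Rintegral.
have mh : measurable_fun setT (EFin \o
    (fun p : borel_rV R d * borel_rV R d => h (row_mx (p.1 : 'rV[R]_d) p.2))).
  by apply/measurable_EFinP; exact: measurable_row_mx.
apply: (measurableT_comp (fine_measurable measurableT)).
under eq_fun do rewrite integralE.
apply: emeasurable_funB.
  rewrite [X in measurable_fun _ X](_ : _ = fubini_G leb (EFin \o
    (fun p : borel_rV R d * borel_rV R d => h (row_mx (p.1 : 'rV[R]_d) p.2)))^\+%E).
    by apply: measurable_fun_fubini_tonelli_G;
      [exact: measurable_funepos|move=> x; exact: funepos_ge0].
  by apply/funext => xi; apply: eq_integral => x _; rewrite !funeposE.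
rewrite [X in measurable_fun _ X](_ : _ = fubini_G leb (EFin \o
  (fun p : borel_rV R d * borel_rV R d => h (row_mx (p.1 : 'rV[R]_d) p.2)))^\-%E).
  by apply: measurable_fun_fubini_tonelli_G;
    [exact: measurable_funeneg|move=> x; exact: funeneg_ge0].
by apply/funext => xi; apply: eq_integral => x _; rewrite !funenegE.
Qed.

Lemma japaneseV_le_powR (x : 'rV[R]_d) : japanese x ^- M <= japanese x `^ (- s).
Proof.
rewrite -powR_invn ?japanese_ge0//; apply: ler_powR; first exact: japanese_ge1.
by rewrite lerN2.
Qed.

Lemma fibre_integral_le h C : 0 <= C -> fibre_decay h C -> forall xi,
  `|fibre_integral h xi| <= C * weight_mass R d * japanese xi ^- M.
Proof.
move=> C0 hC xi; rewrite mulrAC.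
apply: (@normr_Rintegral_decay _ _ (fun x => h (row_mx x xi)) _ (d + d)) => //.
by rewrite mulr_ge0// invr_ge0 exprn_ge0// japanese_ge0.
Qed.

Lemma integral_powR_scale (B : R) : 0 <= B ->
  (\int[mu]_xi (B * japanese xi `^ (- s))%:E)%E = (B * moment)%:E.
Proof.
move=> B0; under eq_integral do rewrite EFinM.
rewrite ge0_integralZl//; last 2 first.
- by apply/measurable_EFinP; exact: measurable_japanese_powR.
- by move=> x _; rewrite lee_fin powR_ge0.
by rewrite momentE EFinM.
Qed.

Lemma integrable_fibre_integral h C : 0 <= C -> continuous h -> fibre_decay h C ->
  mu.-integrable setT (EFin \o fibre_integral h).
Proof.
move=> C0 ch hC; apply/integrableP; split.
  by apply/measurable_EFinP; exact: measurable_fibre_integral.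
have B0 : 0 <= C * weight_mass R d by rewrite mulr_ge0 ?weight_mass_ge0.
apply: (@le_lt_trans _ _ (C * weight_mass R d * moment)%:E); last by rewrite ltry.
rewrite -integral_powR_scale//; apply: ge0_le_integral_nonmeasurable => xi; rewrite ?lee_fin//=.
apply: (le_trans (fibre_integral_le C0 hC xi)).
by apply: ler_wpM2l => //; exact: japaneseV_le_powR.
Qed.

(** The hypothesis bounds the fibre integral and not [h], so that it can be fed with bounds obtained
    from cancellation along the fibre. *)
Lemma real_tensor_le h (B : R) : 0 <= B ->
  (forall xi, `|fibre_integral h xi| <= B * japanese xi `^ (- s)) ->
  `|real_tensor h| <= B * moment.
Proof.
move=> B0 hB.
apply: (@normr_Rintegral_le _ _ _ mu (fibre_integral h)
  (fun xi : 'rV[R]_d => (B * japanese xi `^ (- s))%:E)).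
  by move=> xi; rewrite lee_fin.
by rewrite integral_powR_scale.
Qed.

Lemma real_tensor_decay_le h C : 0 <= C -> fibre_decay h C ->
  `|real_tensor h| <= C * weight_mass R d * moment.
Proof.
move=> C0 hC; have B0 : 0 <= C * weight_mass R d by rewrite mulr_ge0 ?weight_mass_ge0.
apply: real_tensor_le => // xi; apply: (le_trans (fibre_integral_le C0 hC xi)).
by apply: ler_wpM2l => //; exact: japaneseV_le_powR.
Qed.

(* The class of functions on which the pairing is well defined and linear: it
   contains the Schwartz functions and needs no bounds on derivatives. *)
Definition admissible h := continuous h /\ exists2 C : R, 0 <= C & fibre_decay h C.

Lemma admissible_lin (a b : R) h1 h2 : admissible h1 -> admissible h2 ->
  admissible (fun Y => a * h1 Y + b * h2 Y).
Proof.
move=> [ch1 [C1 C10 hC1]] [ch2 [C2 C20 hC2]]; split.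
  move=> Y; apply: (@continuousD R R 'rV[R]_(d + d) (fun Y => a * h1 Y) (fun Y => b * h2 Y) Y).
    by apply: (@continuousM R 'rV[R]_(d + d) (cst a) h1 Y); [exact: cst_continuous|exact: ch1].
  by apply: (@continuousM R 'rV[R]_(d + d) (cst b) h2 Y); [exact: cst_continuous|exact: ch2].
exists (`|a| * C1 + `|b| * C2); first by rewrite addr_ge0 ?mulr_ge0.
move=> x xi; apply: (le_trans (ler_normD _ _)); rewrite !normrM !mulrDl.
by apply: lerD; rewrite -!mulrA; apply: ler_wpM2l => //; rewrite mulrA.
Qed.

Lemma integrable_fibre h xi : admissible h -> leb.-integrable setT (fun x => (h (row_mx x xi))%:E).
Proof.
move=> [ch [C C0 hC]].
apply: (@integrable_decay _ _ (slice xi h) (C * japanese xi ^- M) (d + d)) => //.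
  exact: continuous_slice.
by move=> x; exact: hC.
Qed.

Lemma real_tensor_lin (a b : R) h1 h2 : admissible h1 -> admissible h2 ->
  real_tensor (fun Y => a * h1 Y + b * h2 Y) = a * real_tensor h1 + b * real_tensor h2.
Proof.
move=> n1 n2.
have E : fibre_integral (fun Y => a * h1 Y + b * h2 Y) =
    (fun xi => a * fibre_integral h1 xi + b * fibre_integral h2 xi).
  apply/funext => xi; rewrite /fibre_integral.
  have i1 := integrable_fibre xi n1; have i2 := integrable_fibre xi n2.
  rewrite RintegralD//; first by rewrite !RintegralZl.
    by rewrite /comp; under eq_fun do rewrite EFinM; exact: integrableZl.
  by rewrite /comp; under eq_fun do rewrite EFinM; exact: integrableZl.
rewrite /real_tensor E.
have [c1 [C1 C10 hC1]] := n1; have [c2 [C2 C20 hC2]] := n2.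
have i1 := integrable_fibre_integral C10 c1 hC1.
have i2 := integrable_fibre_integral C20 c2 hC2.
rewrite RintegralD//; first by rewrite !RintegralZl.
  by rewrite /comp; under eq_fun do rewrite EFinM; exact: integrableZl.
by rewrite /comp; under eq_fun do rewrite EFinM; exact: integrableZl.
Qed.

Lemma real_schwartz_admissible h : real_schwartz h -> admissible h.
Proof.
move=> sh; split; first exact: (@real_schwartz_continuous R _ h [::] sh).
have [C C0 H] := slice_decay (d + d) M [::] sh.
by exists C => // x xi; exact: H.
Qed.

(** The sign from the conjugation stays under the integral, so the identity holds for every [F]; for
    the short-time Fourier transform it is absorbed into a phase. *)
Lemma one_tensorE (F : 'rV[R]_(d + d) -> R[i]) : one_tensor mu F =
  Complex (real_tensor (@complex.Re R \o F)) (real_tensor (fun Y => - complex.Im (F Y))).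
Proof.
rewrite /one_tensor /Cintegral /real_tensor /fibre_integral /=.
by congr Complex; apply: eq_Rintegral => xi _; apply: eq_Rintegral => x _ /=;
  case: (F _).
Qed.

Lemma one_tensor_admissibleE (F : 'rV[R]_(d + d) -> R[i]) : admissible (@complex.Im R \o F) ->
  one_tensor mu F = Complex (real_tensor (@complex.Re R \o F)) (- real_tensor (@complex.Im R \o F)).
Proof.
move=> nF; rewrite one_tensorE; congr Complex.
have := real_tensor_lin (-1) 0 nF nF; rewrite mul0r addr0 mulN1r => <-; congr real_tensor.
by apply/funext => Y /=; rewrite mul0r addr0 mulN1r.
Qed.

Lemma fibre_decay_of_japanese (h : 'rV[R]_(d + d) -> R) C : 0 <= C ->
  (forall Y, `|h Y| <= C * japanese Y ^- (d + d + M)) -> fibre_decay h C.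
Proof.
move=> C0 H x xi; apply: (le_trans (H _)); rewrite -mulrA; apply: ler_wpM2l => //.
by rewrite mulrC; exact: japanese_row_mxV.
Qed.

Lemma one_tensor_tempered : tempered_distribution (one_tensor mu).
Proof.
have nRe f : schwartz f -> admissible (@complex.Re R \o f).
  by move=> sf; exact/real_schwartz_admissible/schwartz_Re.
have nIm f : schwartz f -> admissible (@complex.Im R \o f).
  by move=> sf; exact/real_schwartz_admissible/schwartz_Im.
split.
  move=> [a b] f g sf sg.
  have nf := nRe _ sf; have nf' := nIm _ sf; have ng := nRe _ sg; have ng' := nIm _ sg.
  (* The coefficients 1 put both parts into the shape of [real_tensor_lin], applied once to the
     outer and once to the inner combination. *)
  have eR : @complex.Re R \o (fun x => Complex a b * f x + g x) =
      (fun Y => 1 * (a * (@complex.Re R \o f) Y + (- b) * (@complex.Im R \o f) Y) +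
        1 * (@complex.Re R \o g) Y).
    by apply/funext => Y /=; case: (f Y) => p q; case: (g Y) => p' q' /=; ring.
  have eI : @complex.Im R \o (fun x => Complex a b * f x + g x) =
      (fun Y => 1 * (a * (@complex.Im R \o f) Y + b * (@complex.Re R \o f) Y) +
        1 * (@complex.Im R \o g) Y).
    by apply/funext => Y /=; case: (f Y) => p q; case: (g Y) => p' q' /=; ring.
  rewrite !one_tensor_admissibleE//; last first.
    by rewrite eI; apply: admissible_lin => //; exact: admissible_lin.
  rewrite eR eI !real_tensor_lin//; try exact: admissible_lin.
  by apply/eqP; rewrite eq_complex /=; apply/andP; split; apply/eqP; ring.
move=> f sf e e0.
(* The factor 2 accounts for real and imaginary part; dividing by [B + 1] instead of [B] covers
   [B = 0]. *)
pose B := 2 * (weight_mass R d * moment).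
have B0 : 0 <= B by rewrite !mulr_ge0 ?weight_mass_ge0 ?moment_ge0.
have B1 : 0 < B + 1 by rewrite ltr_wpDl.
pose del := e / (B + 1).
have del0 : 0 < del by rewrite divr_gt0.
exists (d + d + M)%N, del => // g sg fg.
(* Only the seminorm of order [d + d + M] without derivatives is used: [d + d] for [x] and [M] for
   [xi]. *)
have gf Y : normc (g Y - f Y) <= del * japanese Y ^- (d + d + M).
  have := fg (d + d + M)%N [::] (leqnn _) isT => H.
  rewrite ler_pdivlMr ?exprn_gt0 ?japanese_gt0// mulrC -lee_fin.
  apply: le_trans (ltW H); apply: ereal_sup_ubound; exists Y => //=.
  by rewrite /Cpderiv /=; case: (_ - _).
have dec (P : R[i] -> R) : (forall z w, P (z - w) = P z - P w) -> (forall z, `|P z| <= normc z) ->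
    admissible (P \o f) -> admissible (P \o g) ->
    `|real_tensor (P \o g) - real_tensor (P \o f)| <= del * weight_mass R d * moment.
  move=> PB Ple nf ng.
  have -> : real_tensor (P \o g) - real_tensor (P \o f) =
      real_tensor (fun Y => 1 * (P \o g) Y + (-1) * (P \o f) Y).
    by rewrite real_tensor_lin// mul1r mulN1r.
  apply: real_tensor_decay_le; first exact: ltW.
  apply: fibre_decay_of_japanese; first exact: ltW.
  by move=> Y /=; rewrite mul1r mulN1r -PB; exact: le_trans (Ple _) (gf Y).
have dR := dec _ (fun z w => raddfB (@complex.Re R) z w) (@normr_Re_le R) (nRe _ sf) (nRe _ sg).
have dI := dec _ (fun z w => raddfB (@complex.Im R) z w) (@normr_Im_le R) (nIm _ sf) (nIm _ sg).
rewrite !one_tensor_admissibleE; [|exact: nIm|exact: nIm].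
apply: (le_lt_trans (normc_le _)) => /=.
rewrite -opprD normrN.
apply: (@le_lt_trans _ _ (del * B)).
  by apply: (le_trans (lerD dR dI)); rewrite /B le_eqVlt; apply/orP; left; apply/eqP; ring.
rewrite /del mulrAC ltr_pdivrMr//.
by rewrite ltr_pM2l// ltrDl.
Qed.

End tensor.

(** * Pointwise bound on the short-time Fourier transform *)

Section stft_bound.
Variables (R : realType) (d : nat).
Implicit Types (G : 'rV[R]_(d + d) -> R) (X Xi : 'rV[R]_(d + d)).
Local Notation leb := (lebesgue_rV R d).
Local Notation normc := ComplexField.Normc.normc.

(** Real counterpart of a time-frequency shift; the free phase [th] lets it express both the real
    and the imaginary part. *)
Definition phased Xi X th G (Y : 'rV[R]_(d + d)) : R := cos (dotp Y Xi + th) * G (Y - X).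

(** Recentring at [x_1] writes the integrand as a translate in [x]; the remaining terms of the dot
    product do not depend on [x] and join the phase. *)
Lemma phased_row_mx G X Xi th (x xi : 'rV[R]_d) :
  phased Xi X th G (row_mx x xi) =
  cos (dotp (x - lsubmx X) (lsubmx Xi) +
    (dotp (lsubmx X) (lsubmx Xi) + dotp xi (rsubmx Xi) + th)) *
  slice (xi - rsubmx X) G (x - lsubmx X).
Proof.
rewrite /phased /slice; congr (cos _ * G _).
  rewrite -{1}(hsubmxK Xi) dotp_row_mx !addrA; congr (_ + _ + _).
  by rewrite -dotpDl subrK.
by rewrite -{1}(hsubmxK X) opp_row_mx add_row_mx.
Qed.

Lemma integrable_fibre_phased G X Xi th xi : real_schwartz G ->
  leb.-integrable setT (fun x => (phased Xi X th G (row_mx x xi))%:E).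
Proof.
move=> sG.
under eq_fun do rewrite phased_row_mx.
have [C C0 H] := slice_decay (d + d) 0 [::] sG.
set eta := xi - _; set x1 := lsubmx X; set th' := dotp _ _ + _ + th.
have cS : continuous (slice eta G).
  exact/continuous_slice/(@real_schwartz_continuous R _ G [::] sG).
have cF : continuous (fun y => cos (dotp y (lsubmx Xi) + th') * slice eta G y).
  move=> y; apply: (@continuousM R 'rV[R]_d
    (fun y => cos (dotp y (lsubmx Xi) + th')) (slice eta G) y).
    exact/continuous_phase/continuous_cos.
  exact: cS.
(* The constant depends on the shift [x1], which is harmless since only integrability for fixed [X]
   is claimed. *)
apply: (@integrable_decay _ _
  (fun x => cos (dotp (x - x1) (lsubmx Xi) + th') * slice eta G (x - x1))
  (C * (2 * japanese (- x1)) ^+ (d + d)) (d + d)) => //.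
  exact: (@continuous_translate R d
    (fun y => cos (dotp y (lsubmx Xi) + th') * slice eta G y) (- x1) cF).
move=> x; have Hx y : `|slice eta G y| <= C * japanese y ^- (d + d).
  by have := H eta y; rewrite expr0 invr1 mulr1.
apply: (le_trans (phase_decay _ _ (@normr_cos_le1 R) Hx _)).
rewrite -mulrA; apply: ler_wpM2l => //.
have := japaneseV_translate (- x1) x (d + d) (_ : `|1| <= 1).
by rewrite scale1r addrC normr1; exact.
Qed.

Lemma fibre_integral_phased G X Xi th xi : real_schwartz G ->
  exists th', fibre_integral (phased Xi X th G) xi =
    osc (lsubmx Xi) th' (slice (xi - rsubmx X) G).
Proof.
move=> sG; exists (dotp (lsubmx X) (lsubmx Xi) + dotp xi (rsubmx Xi) + th).
rewrite /fibre_integral /osc; under eq_Rintegral do rewrite phased_row_mx.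
set th' := dotp _ _ + _ + th; set eta := xi - _.
apply: (@Rintegral_translate _ _ (fun y => cos (dotp y (lsubmx Xi) + th') * slice eta G y)).
move=> y; apply: (@continuousM R 'rV[R]_d
    (fun y => cos (dotp y (lsubmx Xi) + th')) (slice eta G) y).
  exact/continuous_phase/continuous_cos.
exact: (continuous_slice (@real_schwartz_continuous R _ G [::] sG)).
Qed.

Lemma fibre_integral_phasedD_le G1 G2 N M : real_schwartz G1 -> real_schwartz G2 ->
  exists2 K : R, 0 <= K & forall X Xi th1 th2 xi,
    `|fibre_integral (fun Y => phased Xi X th1 G1 Y + phased Xi X th2 G2 Y) xi| <=
    K * japanese (lsubmx Xi) ^- N * japanese (xi - rsubmx X) ^- M.
Proof.
move=> s1 s2; have [K1 K10 H1] := osc_slice_decay N M s1.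
have [K2 K20 H2] := osc_slice_decay N M s2.
exists (K1 + K2); first exact: addr_ge0.
move=> X Xi th1 th2 xi; rewrite /fibre_integral RintegralD//; last 2 first.
- exact: integrable_fibre_phased.
- exact: integrable_fibre_phased.
rewrite -!/(fibre_integral _ xi).
have [t1 ->] := fibre_integral_phased X Xi th1 xi s1.
have [t2 ->] := fibre_integral_phased X Xi th2 xi s2.
by apply: (le_trans (ler_normD _ _)); rewrite !mulrDl; apply: lerD.
Qed.

(** The identities [- sin t = cos (t + pi / 2)] and [- cos t = cos (t + pi)] turn the real part, and
    next the negated imaginary part, into a sum of two [phased] terms. *)
Lemma modulate_translate_Re (Psi : 'rV[R]_(d + d) -> R[i]) X Xi :
  @complex.Re R \o modulate Xi (translate X Psi) =
  (fun Y => phased Xi X 0 (@complex.Re R \o Psi) Y +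
    phased Xi X (pi / 2) (@complex.Im R \o Psi) Y).
Proof.
apply/funext => Y; rewrite /modulate /translate /phased /= cosDpihalf addr0.
by case: (Psi _) => a b /=; rewrite mulNr.
Qed.

Lemma modulate_translate_Im (Psi : 'rV[R]_(d + d) -> R[i]) X Xi :
  (fun Y => - complex.Im (modulate Xi (translate X Psi) Y)) =
  (fun Y => phased Xi X (pi / 2) (@complex.Re R \o Psi) Y +
    phased Xi X pi (@complex.Im R \o Psi) Y).
Proof.
apply/funext => Y; rewrite /modulate /translate /phased /= cosDpihalf cosDpi.
by case: (Psi _) => a b /=; ring.
Qed.

Variable mu : {measure set (borel_rV R d) -> \bar R}.
Variable s : R.
Hypotheses (s_ge0 : 0 <= s) (mu_s : tempered_of_order mu s).

(** Peetre's inequality for [x = (x - y) + y], raised to the power [s] and inverted. *)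
Lemma japanese_peetre_powR (x y : 'rV[R]_d) :
  japanese (x - y) `^ (- s) <= (2 * japanese y) `^ s * japanese x `^ (- s).
Proof.
rewrite !powRN ler_pdivlMr ?powR_gt0 ?japanese_gt0// ler_pdivrMl ?powR_gt0 ?japanese_gt0//.
rewrite -powRM ?mulr_ge0 ?japanese_ge0//.
apply: ge0_ler_powR; rewrite ?nnegrE ?mulr_ge0 ?japanese_ge0//.
have := peetre (x - y) y; rewrite subrK => /le_trans; apply.
by rewrite le_eqVlt; apply/orP; left; apply/eqP; ring.
Qed.

Lemma real_tensor_phasedD_le G1 G2 N : real_schwartz G1 -> real_schwartz G2 ->
  exists2 K : R, 0 <= K & forall X Xi th1 th2,
    `|real_tensor mu (fun Y => phased Xi X th1 G1 Y + phased Xi X th2 G2 Y)| <=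
    K * japanese (rsubmx X) `^ s * japanese (lsubmx Xi) ^- N.
Proof.
(* Schwartz decay is available in integer orders, so [s] is rounded up. *)
move=> s1 s2; pose M := Num.bound s.
have sM : s <= M%:R by apply/ltW/archi_boundP.
have [K K0 H] := fibre_integral_phasedD_le N M s1 s2.
exists (K * 2 `^ s * moment mu s); first by rewrite !mulr_ge0 ?powR_ge0 ?moment_ge0.
move=> X Xi th1 th2.
have J0 : 0 <= japanese (lsubmx Xi) ^- N by rewrite invr_ge0 exprn_ge0// japanese_ge0.
set B := K * japanese (lsubmx Xi) ^- N * (2 * japanese (rsubmx X)) `^ s.
have B0 : 0 <= B by rewrite !mulr_ge0 ?powR_ge0.
apply: (le_trans (real_tensor_le mu_s B0 _)).
  move=> xi; apply: (le_trans (H _ _ _ _ _)).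
  rewrite /B -[leRHS]mulrA; apply: ler_wpM2l; first exact: mulr_ge0.
  apply: le_trans (japanese_peetre_powR xi (rsubmx X)); exact: japaneseV_le_powR.
rewrite /B powRM ?japanese_ge0// le_eqVlt; apply/orP; left; apply/eqP; ring.
Qed.

Lemma stft_one_tensor_le (Psi : 'rV[R]_(d + d) -> R[i]) N : schwartz Psi ->
  exists2 K : R, 0 <= K & forall X Xi,
    normc (stft Psi (one_tensor mu) X Xi) <=
    K * japanese (rsubmx X) `^ s * japanese (lsubmx Xi) ^- N.
Proof.
move=> sP; have sRe := schwartz_Re sP; have sIm := schwartz_Im sP.
have [K K0 H] := real_tensor_phasedD_le N sRe sIm.
have c0 : 0 <= (2 * pi) ^- d :> R by rewrite invr_ge0 exprn_ge0// mulr_ge0// pi_ge0.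
exists ((2 * pi) ^- d * (K + K)); first by rewrite mulr_ge0 ?addr_ge0.
move=> X Xi; rewrite /stft ComplexField.Normc.normcM.
rewrite [X in X * _](_ : _ = (2 * pi) ^- d); last first.
  by rewrite /= expr0n addr0 sqrtr_sqr ger0_norm.
rewrite -!mulrA; apply: ler_wpM2l => //.
apply: (le_trans (normc_le _)); rewrite one_tensorE modulate_translate_Re modulate_translate_Im /=.
rewrite [leRHS](_ : _ = K * japanese (rsubmx X) `^ s * japanese (lsubmx Xi) ^- N +
  K * japanese (rsubmx X) `^ s * japanese (lsubmx Xi) ^- N); last by ring.
by apply: lerD; exact: H.
Qed.

End stft_bound.

(** * Membership in the weighted modulation space *)

Theorem proposition5p5 (R : realType) (d : nat)
    (mu : {measure set (borel_rV R d) -> \bar R}) (s : R)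
    (mu_radon : radon mu) (mu_tempered : tempered mu)
    (s_ge0 : 0 <= s) (mu_s : tempered_of_order mu s)
    (n : nat) (eps : R) (eps_gt0 : 0 < eps)
    (Psi : 'rV[R]_(d + d) -> R[i])
    (Psi_schwartz : schwartz Psi) (Psi_neq0 : Psi <> (fun=> 0)) :
  modulation_space Psi
    (fun X Xi : 'rV[R]_(d + d) =>
       japanese (rsubmx X) `^ (- s) * japanese (lsubmx Xi) ^+ n *
       japanese (rsubmx Xi) `^ (- d%:R - eps))
    (one_tensor mu).
Proof.
split.
  by apply: (@one_tensor_tempered R d mu s (Num.bound s)) => //; apply/ltW/archi_boundP.
(* Any [p > 1] makes the weight integrable, while [p * d <= d + eps] lets the decay in [xi_2]
   dominate it. The denominator [d + 1] instead of [d] admits [d = 0]. *)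
pose p := 1 + eps / d.+1%:R.
have d0 : 0 < d.+1%:R :> R by rewrite ltr0Sn.
have p1 : 1 < p by rewrite ltrDl divr_gt0.
have p0 : 0 <= p by apply/ltW/(lt_trans ltr01 p1).
pose k := Num.bound (p * d%:R).
have pk : p * d%:R <= k%:R by apply/ltW/archi_boundP; rewrite mulr_ge0.
have pd : p * d%:R <= d%:R + eps.
  rewrite /p mulrDl mul1r lerD2l mulrAC ler_pdivrMr// ler_pM2l//.
  by rewrite ler_nat.
(* Of the [n + k] orders of decay in [xi_1], the weight consumes [n]; the other [k >= p * d] provide
   integrability. *)
have [K K0 H] := stft_one_tensor_le s_ge0 mu_s (n + k) Psi_schwartz.
apply: (@le_lt_trans _ _ (\int[lebesgue_rV R (d + d)]_Xi (K * weight p Xi)%:E)%E).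
  apply: ge0_le_integral_nonmeasurable => Xi.
    (* The supremum is nonnegative because its term at [X = 0] is. *)
    apply: (@le_trans _ _ _ _ _ _ (ereal_sup_ubound _)); last by exists 0.
    by rewrite lee_fin !mulr_ge0 ?normc_ge0 ?powR_ge0 ?exprn_ge0 ?japanese_ge0.
  apply: ge_ereal_sup => _ [X _ <-]; rewrite lee_fin.
  set w := (X in ComplexField.Normc.normc _ * X).
  have w0 : 0 <= w by rewrite /w !mulr_ge0 ?powR_ge0 ?exprn_ge0 ?japanese_ge0.
  apply: (le_trans (ler_wpM2r w0 (H X Xi))).
  (* The growth in [x_2] cancels exactly against the weight, so the bound no longer depends on [X]
     and passes to the supremum. *)
  have jX : japanese (rsubmx X) `^ s * japanese (rsubmx X) `^ (- s) = 1.
    rewrite -powRD; first by rewrite subrr powRr0.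
    by apply/implyP => _; rewrite gt_eqF// japanese_gt0.
  have jXi : japanese (lsubmx Xi) ^- (n + k) * japanese (lsubmx Xi) ^+ n =
       japanese (lsubmx Xi) ^- k.
    by rewrite exprD invfM mulrAC mulVf ?mul1r// expf_neq0// gt_eqF// japanese_gt0.
  have regroup (a b c a' b' e : R) : a * b * c * (a' * b' * e) = a * ((b * a') * (c * b') * e).
    by ring.
  rewrite /w regroup jX jXi mul1r; apply: ler_wpM2l => //.
  (* The product weight on [R^(2 d)] factors over the blocks [xi_1] and [xi_2], which are dominated
     separately with exponents [k] and [d + eps]. *)
  rewrite /weight big_split_ord/=.
  apply: ler_pM; rewrite ?powR_ge0 ?invr_ge0 ?exprn_ge0 ?japanese_ge0//.
    rewrite (eq_bigr (fun i => weight1 p (lsubmx Xi ord0 i))); last by move=> i _; rewrite mxE.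
    exact: japaneseV_le_weight.
  rewrite (eq_bigr (fun i => weight1 p (rsubmx Xi ord0 i))); last by move=> i _; rewrite mxE.
  by rewrite -opprD; exact: japanese_le_weight.
under eq_integral do rewrite EFinM.
rewrite ge0_integralZl//; last 2 first.
- by apply/measurable_EFinP; exact: measurable_weight.
- by move=> x _; rewrite lee_fin weight_ge0.
by apply: lte_mul_pinfty; rewrite ?lee_fin//; exact: integral_weight_lty.
Qed.
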